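(* Let $m,n,s,k,c$ be positive integers such that $2\leq s\leq n$, $2\leq k\leq m$ and $ms=nk$. A magic rectangle set $\mathrm{MRS}(m,n;s,k;c)$ exists if and only if either $nkc$ is odd, or $s$ and $k$ are both even and $sk>4$.
   Context: Let $(\Gamma,+)$ be an abelian group and $\Omega\subseteq\Gamma$ with $|\Omega|>1$. A partially filled array is an array in which some cells may be empty. A magic partially filled array set $\mathrm{MS}_\Omega(m,n;s,k;c)$ is a set of $c$ partially filled $m\times n$ arrays with entries in $\Omega$ such that: every element of $\Omega$ appears exactly once, in exactly one of the arrays; in every array each row contains exactly $s$ filled cells and each column exactly $k$ filled cells; and there exist (not necessarily distinct) $x,y\in\Gamma$ such that in every array the entries of each row sum to $x$ and the entries of each column sum to $y$. A magic rectangle set with empty cells $\mathrm{MRS}(m,n;s,k;c)$ is an $\mathrm{MS}_\Omega(m,n;s,k;c)$ with $\Omega=\{1,2,\ldots,nkc\}\subset(\mathbb Z,+)$. *)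

(* Defs.v *)
From mathcomp Require Import all_boot.
Unset Printing Implicit Defensive.

(* A set of c partially filled m x n arrays with natural-number entries:
   A a i j = None means cell (i,j) of array a is empty,
   A a i j = Some v means it contains v. *)
Definition pf_arrays (c m n : nat) := 'I_c -> 'I_m -> 'I_n -> option nat.

Definition row_sum {c m n} (A : pf_arrays c m n) (a : 'I_c) (i : 'I_m) : nat :=
  \sum_(j < n) odflt 0 (A a i j).

Definition col_sum {c m n} (A : pf_arrays c m n) (a : 'I_c) (j : 'I_n) : nat :=
  \sum_(i < m) odflt 0 (A a i j).

(* A is an MRS(m,n;s,k;c): an MS_Omega(m,n;s,k;c) with
   Omega = {1,...,nkc} in (Z,+).  Since all entries are positive integers,
   the common row/column sums x, y are naturals. *)
Definition is_MRS (m n s k c : nat) (A : pf_arrays c m n) : Prop :=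
  (forall a i j v, A a i j = Some v -> 1 <= v <= n * k * c) /\
  (forall v, 1 <= v <= n * k * c ->
     #|[set t : 'I_c * 'I_m * 'I_n | A t.1.1 t.1.2 t.2 == Some v]| = 1) /\
  (forall a i, #|[set j : 'I_n | A a i j != None]| = s) /\
  (forall a j, #|[set i : 'I_m | A a i j != None]| = k) /\
  (exists x y : nat,
     (forall a i, row_sum A a i = x) /\ (forall a j, col_sum A a j = y)).

Definition MRS_exists (m n s k c : nat) : Prop :=
  exists A : pf_arrays c m n, is_MRS m n s k c A.

(* Main.v *)
(** Necessity is a count of the total of all entries, plus the remark that for
    [s = k = 2] the entry completing a row to the common sum would also be the
    entry completing a column. For existence all entries are centred at 0, so
    that row and column sums have to vanish.

    Even [s], [k]: the cells of a column are paired as [z], [-z] in such a way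
    that row [p] receives a bundle of [s/2] signed labels and the opposite of
    the bundle of row [p - 1]; it suffices that all bundles of a cyclic group of
    rows have the same sum. Labels are grouped in consecutive pairs, in
    quadruples [+ - - +], and in triples or sextuples when [s/2] is odd.

    Odd [n k c]: with centred representatives [cen] modulo [2h + 1],
    [cen x + cen (x + h) + cen (- 2 x - h) = 0] holds in Z. These Kotzig triples,
    together with opposite pairs, serve as low digits in every blow-up; hence
    only two kinds of base arrays are needed. If [e = gcd(s, k) >= 3], it is a
    square array filled on [e] cyclic diagonals. If [s] and [k] are coprime, it
    is a full [k * s] rectangle, whose labels have a high digit in [Z_k] and a
    low digit in [Z_s]. *)

Require Import Defs.
From mathcomp Require Import all_boot all_order all_fingroup all_algebra zify.
Set Implicit Arguments.
Unset Strict Implicit.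
Unset Printing Implicit Defensive.
Import Order.TTheory GRing.Theory Num.Theory.
Local Open Scope nat_scope.

(** * From labellings to magic rectangle sets *)

(** Lets the constructions index arrays, rows, columns and filled cells by arbitrary finite types,
    such as products with cyclic groups. Labels start at 0, hence the successors; being injective
    and below [#|X|], [lab] is a bijection by counting. *)
Lemma MRS_of_labelling (G R Q X : finType) (ar : X -> G) (ro : X -> R)
    (co : X -> Q) (lab : X -> nat) (s k x y : nat) :
  injective (fun t => (ar t, ro t, co t)) ->
  injective lab -> (forall t, lab t < #|X|) ->
  (forall g r, #|[pred t | (ar t == g) && (ro t == r)]| = s) ->
  (forall g q, #|[pred t | (ar t == g) && (co t == q)]| = k) ->
  (forall g r, \sum_(t | (ar t == g) && (ro t == r)) (lab t).+1 = x) ->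
  (forall g q, \sum_(t | (ar t == g) && (co t == q)) (lab t).+1 = y) ->
  MRS_exists #|R| #|Q| s k #|G|.
Proof.
move=> pos_inj lab_inj lab_lt rowc colc rows cols.
have cardX : #|X| = #|Q| * k * #|G|.
  rewrite -sum1_card (partition_big (fun t => (ar t, co t)) xpredT) //=.
  rewrite (eq_bigr (fun=> k)) => [|[g q] _]; last first.
    by rewrite -(colc g q) -sum1_card; apply: eq_bigl => t; rewrite xpair_eqE.
  by rewrite sum_nat_const card_prod -mulnA mulnC.
pose P (a : 'I_#|G|) (i : 'I_#|R|) (j : 'I_#|Q|) t :=
  [&& ar t == enum_val a, ro t == enum_val i & co t == enum_val j].
pose A (a : 'I_#|G|) (i : 'I_#|R|) (j : 'I_#|Q|) :=
  omap (fun t => (lab t).+1) [pick t | P a i j t].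
have P_inj a i j t u : P a i j t -> P a i j u -> t = u.
  move=> /and3P[/eqP a1 /eqP b1 /eqP c1] /and3P[/eqP a2 /eqP b2 /eqP c2].
  by apply: pos_inj; rewrite /= a1 b1 c1 a2 b2 c2.
have AP a i j t : P a i j t -> A a i j = Some (lab t).+1.
  move=> Pt; rewrite /A; case: pickP => [u Pu|/(_ t)]; last by rewrite Pt.
  by rewrite (P_inj _ _ _ _ _ Pu Pt).
have Anone a i j : A a i j != None -> exists t, P a i j t.
  by rewrite /A; case: pickP => [t Pt _|//]; exists t.
have Prank t : P (enum_rank (ar t)) (enum_rank (ro t)) (enum_rank (co t)) t.
  by rewrite /P !enum_rankK !eqxx.
have pick_sum a i j : odflt 0 (A a i j) = \sum_(t | P a i j t) (lab t).+1.
  rewrite /A; case: pickP => [t Pt|no] /=; last by rewrite big_pred0.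
  rewrite (big_pred1 t) // => u; apply/idP/eqP => [Pu|-> //].
  exact: P_inj Pu Pt.
have lab_surj v : v < #|X| -> exists t, lab t = v.
  move=> lt_v; pose f t := Ordinal (lab_lt t).
  have f_inj : injective f by move=> t u /(congr1 val); apply: lab_inj.
  have [g fg gf] : bijective f by apply: inj_card_bij => //; rewrite card_ord.
  by exists (g (Ordinal lt_v)); have /(congr1 val) := gf (Ordinal lt_v).
exists A; split; [|split; [|split; [|split]]].
- move=> a i j v; rewrite /A; case: pickP => //= t _ [<-].
  by rewrite -cardX lab_lt.
- move=> [|v] //; rewrite -cardX => /andP[_ /lab_surj[t <-]].
  pose w := (enum_rank (ar t), enum_rank (ro t), enum_rank (co t)).
  apply/eqP/cards1P; exists w; apply/setP=> -[[a i] j]; rewrite !inE /=.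
  apply/eqP/eqP => [eqA|[-> -> ->]]; last exact: AP.
  have [|u Pu] := Anone a i j; first by rewrite eqA.
  move: eqA; rewrite (AP _ _ _ _ Pu) => -[/lab_inj eq_ut].
  move: Pu; rewrite eq_ut => /and3P[/eqP e1 /eqP e2 /eqP e3].
  by rewrite /w e1 e2 e3 !enum_valK.
- move=> a i; rewrite -(rowc (enum_val a) (enum_val i)).
  rewrite -(card_in_image (f := fun t => enum_rank (co t))); last first.
    move=> t u; rewrite !inE => /andP[/eqP a1 /eqP b1] /andP[/eqP a2 /eqP b2].
    by move=> /enum_rank_inj c12; apply: pos_inj; rewrite /= a1 b1 c12 a2 b2.
  rewrite cardsE; apply: eq_card => j; rewrite unfold_in.
  apply/idP/imageP => [/Anone[t]|[t]].
    case/and3P=> at_ rt ct; exists t; first by rewrite inE at_ rt.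
    by rewrite (eqP ct) enum_valK.
  rewrite inE => /andP[at_ rt ->].
  by rewrite (AP _ _ _ t) // /P at_ rt enum_rankK eqxx.
- move=> a j; rewrite -(colc (enum_val a) (enum_val j)).
  rewrite -(card_in_image (f := fun t => enum_rank (ro t))); last first.
    move=> t u; rewrite !inE => /andP[/eqP a1 /eqP b1] /andP[/eqP a2 /eqP b2].
    by move=> /enum_rank_inj c12; apply: pos_inj; rewrite /= a1 b1 c12 a2 b2.
  rewrite cardsE; apply: eq_card => i; rewrite unfold_in.
  apply/idP/imageP => [/Anone[t]|[t]].
    case/and3P=> at_ rt ct; exists t; first by rewrite inE at_ ct.
    by rewrite (eqP rt) enum_valK.
  rewrite inE => /andP[at_ rt ->].
  by rewrite (AP _ _ _ t) // /P at_ rt enum_rankK eqxx.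
- exists x, y; split=> [a i|a j].
    rewrite -(rows (enum_val a) (enum_val i)) /row_sum.
    rewrite (partition_big (fun t => enum_rank (co t)) xpredT) //=.
    apply: eq_bigr => j _; rewrite pick_sum; apply: eq_bigl => t.
    by rewrite /P andbA -(inj_eq enum_val_inj) enum_rankK.
  rewrite -(cols (enum_val a) (enum_val j)) /col_sum.
  rewrite (partition_big (fun t => enum_rank (ro t)) xpredT) //=.
  apply: eq_bigr => i _; rewrite pick_sum; apply: eq_bigl => t.
  by rewrite /P -(inj_eq enum_val_inj) enum_rankK -andbA [(ro t == _) && _]andbC.
Qed.

Lemma MRS_exists_transpose (m n s k c : nat) :
  m * s = n * k -> MRS_exists m n s k c -> MRS_exists n m k s c.
Proof.
move=> eqT [A [A1 [A2 [A3 [A4 [x [y [A5 A6]]]]]]]].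
exists (fun a j i => A a i j); split; [|split; [|split; [|split]]] => //.
- by move=> a i j v /A1; rewrite eqT.
- rewrite eqT => v /A2 <-.
  pose f (t : 'I_c * 'I_n * 'I_m) := (t.1.1, t.2, t.1.2).
  have f_inj : injective f by move=> [[? ?] ?] [[? ?] ?] [-> -> ->].
  rewrite -(card_imset _ f_inj); apply: eq_card => -[[a i] j].
  rewrite [RHS]inE /=; apply/imsetP/idP => [[[[a' j'] i']]|].
    by rewrite inE /= => Av [-> -> ->].
  by move=> Av; exists (a, j, i); rewrite ?inE.
- by exists y, x.
Qed.

(** * Necessity *)

Section Necessity.
Variables (m n s k c x y : nat) (A : pf_arrays c m n).
Let T := n * k * c.
Hypothesis rng : forall a i j v, A a i j = Some v -> 1 <= v <= T.
Hypothesis uniq_entry : forall v, 1 <= v <= T ->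
  #|[set t : 'I_c * 'I_m * 'I_n | A t.1.1 t.1.2 t.2 == Some v]| = 1.
Hypothesis rows : forall a i, row_sum A a i = x.
Hypothesis cols : forall a j, col_sum A a j = y.

(** Double counting: each entry is expanded over the values [v] it equals, and each positive [v] is
    hit by one cell. The extra value 0 contributes nothing. Doubling avoids halving [T * T.+1]. *)
Lemma total_entries :
  \sum_(t : 'I_c * 'I_m * 'I_n) (odflt 0 (A t.1.1 t.1.2 t.2) * 2) = T * T.+1.
Proof.
transitivity ((\sum_(v < T.+1) v) * 2); last first.
  rewrite -(big_mkord xpredT id) bin2_sum bin2 muln2 halfK /= oddM /= andNb.
  by rewrite subn0 mulnC.
rewrite -big_distrl /=; congr (_ * _).
transitivity (\sum_(t : 'I_c * 'I_m * 'I_n)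
                \sum_(v < T.+1 | A t.1.1 t.1.2 t.2 == Some (v : nat)) (v : nat)).
  apply: eq_bigr => t _; case E: (A _ _ _) => [v|] /=; last by rewrite big_pred0.
  have /andP[_ lev] := rng E.
  by rewrite (big_pred1 (Ordinal (lev : v < T.+1))) // => w; rewrite eq_sym.
rewrite (exchange_big_dep predT) //=; apply: eq_bigr => v _.
rewrite sum_nat_const; case: (posnP v) => [->|v_gt0]; first by rewrite muln0.
have := @uniq_entry v; rewrite v_gt0 -ltnS ltn_ord cardsE => -> //.
by rewrite mul1n.
Qed.

Lemma row_total : \sum_(t : 'I_c * 'I_m * 'I_n) odflt 0 (A t.1.1 t.1.2 t.2) = c * m * x.
Proof.
rewrite -(pair_bigA _ (fun p j => odflt 0 (A p.1 p.2 j))) /=.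
rewrite (eq_bigr (fun=> x)); last by move=> [a i] _; apply: rows.
by rewrite sum_nat_const card_prod !card_ord.
Qed.

Lemma col_total : \sum_(t : 'I_c * 'I_m * 'I_n) odflt 0 (A t.1.1 t.1.2 t.2) = c * n * y.
Proof.
rewrite -(pair_bigA _ (fun p j => odflt 0 (A p.1 p.2 j))) /=.
rewrite -(pair_bigA _ (fun a i => \sum_j odflt 0 (A a i j))) /=.
under eq_bigr do rewrite exchange_big.
rewrite (eq_bigr (fun=> n * y)); last first.
  move=> a _; rewrite (eq_bigr (fun=> y)); last by move=> j _; apply: cols.
  by rewrite sum_nat_const card_ord.
by rewrite sum_nat_const card_ord mulnA.
Qed.

End Necessity.

Lemma MRS_necessary (m n s k c : nat) :
  0 < m -> 0 < n -> 0 < c -> 2 <= s -> 2 <= k -> m * s = n * k ->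
  MRS_exists m n s k c ->
  odd (n * k * c) \/ (~~ odd s /\ ~~ odd k /\ 4 < s * k).
Proof.
move=> m0 n0 c0 s2 k2 eqT [A [A1 [A2 [A3 [A4 [x [y [A5 A6]]]]]]]].
have [|evT] := boolP (odd _); [by left|right].
pose T := n * k * c; have T0 : 0 < T by rewrite !muln_gt0 n0 c0 (ltnW k2).
have tot : _ * 2 = T * T.+1 := etrans (big_distrl _ _ _) (total_entries A1 A2).
have eqx : x * 2 = s * T.+1.
  have := tot; rewrite (row_total A5) /T -eqT => h.
  have : c * m * (x * 2) = c * m * (s * (m * s * c).+1) by lia.
  by move/eqP; rewrite eqn_pmul2l ?muln_gt0 ?c0 // => /eqP.
have eqy : y * 2 = k * T.+1.
  have := tot; rewrite (col_total A6) /T => h.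
  have : c * n * (y * 2) = c * n * (k * (n * k * c).+1) by lia.
  by move/eqP; rewrite eqn_pmul2l ?muln_gt0 ?c0 // => /eqP.
(* As [T] is even, [T.+1] is odd, so the doubled row sum [s * T.+1] forces [s] to be even; the same
   holds for [k]. *)
have evs : ~~ odd s.
  by have /(congr1 odd) := eqx; rewrite !oddM /= andbF (negbTE evT) andbT => <-.
have evk : ~~ odd k.
  by have /(congr1 odd) := eqy; rewrite !oddM /= andbF (negbTE evT) andbT => <-.
split=> //; split=> //; rewrite ltnNge; apply/negP => sk4.
have es : s = 2 by nia.
have ek : k = 2 by nia.
have exT : x = T.+1 by lia.
have eyT : y = T.+1 by lia.
have /eqP/cards1P[[[a i] j] /setP/(_ (a, i, j))] := A2 1 T0.
rewrite !inE /= eqxx => /eqP A1aij.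
(* In its row, as in its column, the entry 1 has a single companion, which must be T. *)
have [j' nj Aj'] : exists2 j', j' != j & A a i j' = Some T.
  have : #|[set j | A a i j != None] :\ j| = 1.
    by have := cardsD1 j [set j | A a i j != None]; rewrite A3 es inE A1aij /=; lia.
  move/eqP/cards1P=> [j' eqj']; exists j'.
    by have := set11 j'; rewrite -eqj' !inE => /andP[].
  have := A5 a i; rewrite /row_sum exT (bigD1 j) //= A1aij /= add1n => -[].
  rewrite (bigD1 j') /=; last by have := set11 j'; rewrite -eqj' !inE => /andP[].
  rewrite big1 => [|j'' /andP[n1 n2]].
    by rewrite addn0; case: (A a i j') => //= [v ->|e0] //; rewrite -e0 in T0.
  move/setP/(_ j''): eqj'; rewrite !inE n1 (negbTE n2) /=.
  by case: (A a i j'').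
have [i' ni Ai'] : exists2 i', i' != i & A a i' j = Some T.
  have : #|[set i | A a i j != None] :\ i| = 1.
    by have := cardsD1 i [set i | A a i j != None]; rewrite A4 ek inE A1aij /=; lia.
  move/eqP/cards1P=> [i' eqi']; exists i'.
    by have := set11 i'; rewrite -eqi' !inE => /andP[].
  have := A6 a j; rewrite /col_sum eyT (bigD1 i) //= A1aij /= add1n => -[].
  rewrite (bigD1 i') /=; last by have := set11 i'; rewrite -eqi' !inE => /andP[].
  rewrite big1 => [|i'' /andP[n1 n2]].
    by rewrite addn0; case: (A a i' j) => //= [v ->|e0] //; rewrite -e0 in T0.
  move/setP/(_ i''): eqi'; rewrite !inE n1 (negbTE n2) /=.
  by case: (A a i'' j).
(* [T] now sits both in row [i] off column [j] and in column [j] off row [i], against its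
   uniqueness. *)
have leT : 1 <= T <= n * k * c by rewrite T0 leqnn.
have /eqP/cards1P[t /setP eqt] := A2 T leT.
have := eqt (a, i, j'); have := eqt (a, i', j).
rewrite !inE /= Aj' Ai' eqxx => /esym/eqP <- /esym/eqP[_ e2].
by rewrite e2 eqxx in nj.
Qed.

Local Open Scope ring_scope.

(** * Centred residues and Kotzig arrays *)

(** The class of 1. For general [d] only the additive group structure of ['I_d.+1] is at hand, so
    residues are written as multiples [zone *+ n]. *)
Definition zone {d : nat} : 'I_d.+1 := inZp 1.

Lemma val_mul_zone d n : (zone *+ n : 'I_d.+1) = (n %% d.+1)%N :> nat.
Proof. by rewrite Zp_mulrn /= modnMml mul1n. Qed.

Section CentredResidues.
Variable h : nat.
Local Notation Z := 'I_h.*2.+1.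
Implicit Types x y : Z.

Definition cen x : int := if (x <= h)%N then x%:Z else x%:Z - h.*2.+1%:Z.

Lemma cen_inj : injective cen.
Proof.
move=> x y; rewrite /cen => E; apply: val_inj => /=.
have ltx := ltn_ord x; have lty := ltn_ord y; move: E.
by do 2 case: leqP => ?; lia.
Qed.

Lemma cen_bound x : `|cen x| <= h%:Z.
Proof. by rewrite /cen; have ltx := ltn_ord x; case: leqP; lia. Qed.

Lemma val_addZ x y :
  (x + y : Z) = (if (x + y < h.*2.+1)%N then x + y else x + y - h.*2.+1)%N :> nat.
Proof.
rewrite /=; have ltx := ltn_ord x; have lty := ltn_ord y.
case: (ltnP (x + y)) => [lt|ge].
  by rewrite modn_small.
by rewrite -[X in (X %% _)%N](subnK ge) modnDr modn_small //; lia.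
Qed.

Lemma val_oppZ x : (- x : Z) = (if x == 0%N :> nat then 0 else h.*2.+1 - x)%N :> nat.
Proof.
rewrite /=; have ltx := ltn_ord x; case: eqP => [->|nz].
  by rewrite subn0 modnn.
by rewrite modn_small //; lia.
Qed.

Lemma cenN x : cen (- x) = - cen x.
Proof.
rewrite /cen val_oppZ; have ltx := ltn_ord x.
by case: eqP => ?; repeat (case: leqP => ?); lia.
Qed.

Lemma cen0 : cen 0 = 0. Proof. by rewrite /cen. Qed.

Lemma sum_cen : \sum_x cen x = 0.
Proof.
have : \sum_x cen x = - \sum_x cen x.
  rewrite -sumrN (reindex_inj oppr_inj) /=.
  by apply: eq_bigr => x _; rewrite cenN.
by lia.
Qed.

(** Modulo [2h + 1] one has [2h = - 1], so this is minus one half; likewise [x *+ h] is minus one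
    half of [x]. *)
Definition zhalf : Z := inZp h.

Lemma val_zhalf : zhalf = h :> nat.
Proof. by rewrite /= modn_small //; lia. Qed.

Lemma mulZ_order x : x *+ h.*2.+1 = 0.
Proof. by apply: val_inj; rewrite Zp_mulrn /= modnMl. Qed.

Lemma zone_mulh : zone *+ h = zhalf.
Proof. by apply: val_inj; rewrite Zp_mulrn /= modnMml mul1n. Qed.

Lemma zhalf2 : zhalf + zhalf = - zone.
Proof.
apply/eqP; rewrite -addr_eq0 -{1 2}zone_mulh -mulrnDr -mulrSr addnn.
by rewrite mulZ_order.
Qed.

Lemma mulhD x : x *+ h + x *+ h = - x.
Proof.
by apply/eqP; rewrite -mulrnDr -addr_eq0 -mulrSr addnn mulZ_order.
Qed.


Lemma mulh_inj : injective (fun x => x *+ h).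
Proof. by move=> x y E; apply: oppr_inj; rewrite -!mulhD E. Qed.

Lemma addZZ_inj : injective (fun x => x + x).
Proof.
move=> x y E; apply: oppr_inj; rewrite -!mulhD -!mulrnDl.
by congr (_ *+ _).
Qed.

(* The wrap-arounds compensate exactly: [x + zhalf] and [- x - x - zhalf] are the
   second and third rows of a Kotzig array whose columns sum to 0 in Z. *)
Lemma cen_kotzig x : cen x + cen (x + zhalf) + cen (- (x + x) - zhalf) = 0.
Proof.
rewrite -opprD cenN; have ltx := ltn_ord x.
have := val_addZ x zhalf; have := val_addZ (x + x) zhalf; have := val_addZ x x.
rewrite val_zhalf /cen; move: (x + zhalf) (x + x) => y z.
move: (z + zhalf) => w.
case: (ltnP (x + x)) => ? -> ; case: (ltnP _ _.+1) => ? ->.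
  all: case: (ltnP (x + h)) => ? ->; do 3 case: leqP => ?; lia.
Qed.

Definition kotzig (i : nat) x : Z :=
  match i with 0 => x | 1 => x + zhalf | _ => - (x + x) - zhalf end.

Lemma kotzig_inj i : injective (kotzig i).
Proof.
case: i => [|[|i]] x y //=; first exact: addIr.
by move=> /addIr/oppr_inj/addZZ_inj.
Qed.

Lemma sum_kotzig x : \sum_(i < 3) cen (kotzig i x) = 0.
Proof. by rewrite !big_ord_recl big_ord0 /= addr0 addrA cen_kotzig. Qed.

Definition twist (t : bool * nat) x : int := (-1) ^+ t.1 * cen (kotzig t.2 x).

Lemma twist_inj t : injective (twist t).
Proof.
case: t => b i x y; rewrite /twist => /(mulfI _) E.
by apply/(@kotzig_inj i)/cen_inj/E; rewrite signr_eq0.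
Qed.

Lemma twist_bound t x : `|twist t x| <= h%:Z.
Proof. by rewrite /twist normrM normrX normrN1 expr1n mul1r cen_bound. Qed.

End CentredResidues.
Arguments zhalf {h}.

(** * Odd case: blowing up a base array *)

(* [tau y] selects the Kotzig row, up to sign, used as low digit in all the cells
   replacing the cell [y] in a blow-up. *)
Record odd_base (P Q Y : finType) (r : Y -> P) (q : Y -> Q) (s k H : nat)
    (L : Y -> int) (tau : Y -> bool * nat) : Prop := OddBase {
  ob_inj : injective (fun y => (r y, q y));
  ob_rcard : forall p, #|[pred y | r y == p]| = s;
  ob_ccard : forall p, #|[pred y | q y == p]| = k;
  ob_card : #|Y| = H.*2.+1;
  ob_Linj : injective L;
  ob_Lbound : forall y, `|L y| <= H%:Z;
  ob_rsum : forall p, \sum_(y | r y == p) L y = 0;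
  ob_csum : forall p, \sum_(y | q y == p) L y = 0;
  ob_rtwist : forall h (z : 'I_h.*2.+1) p, \sum_(y | r y == p) twist (tau y) z = 0;
  ob_ctwist : forall h (z : 'I_h.*2.+1) p, \sum_(y | q y == p) twist (tau y) z = 0
}.

(** Each base cell gets one copy for each element of [G * D * U * V]: [G] selects the array, [D] a
    diagonal block, [U] and [V] subdivide rows and columns. The base label is the high digit, a
    twist of the rank of the copy the low digit. Along a row with [v] fixed the rank is constant, so
    the twists cancel by [ob_rtwist]; columns are similar. *)
Lemma MRS_of_odd_base (P Q Y : finType) (r : Y -> P) (q : Y -> Q) (s k H : nat)
    (L : Y -> int) (tau : Y -> bool * nat) (G D U V : finType) :
  odd_base r q s k H L tau -> odd #|[set: G * D * U * V]| ->
  MRS_exists #|[set: D * P * U]| #|[set: D * Q * V]| (s * #|V|) (k * #|U|) #|G|.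
Proof.
case=> rq_inj rcard ccard cardY L_inj L_bound rsum csum rtw ctw.
rewrite !cardsT; set N := #|{: G * D * U * V}| => oddN.
pose h := N./2; have eN : N = h.*2.+1 by rewrite -[LHS]odd_double_half oddN.
pose rank (z : G * D * U * V) : 'I_h.*2.+1 := cast_ord eN (enum_rank z).
have rank_inj : injective rank by move=> z w /cast_ord_inj/enum_rank_inj.
pose X := (Y * (G * D * U * V))%type.
pose li (t : X) : int := N%:Z * L t.1 + twist (tau t.1) (rank t.2).
(* The centred labels lie between [- C] and [C], and there are [2C + 1] cells; adding [C] makes them
   start at 0. *)
pose C := (N * H + h)%N.
have li_bound t : `|li t| <= C%:Z.
  have := L_bound t.1; have := twist_bound (tau t.1) (rank t.2).
  by rewrite /li /C; nia.
pose lab (t : X) : nat := absz (li t + C%:Z).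
have labE t : (lab t)%:Z = li t + C%:Z by have := li_bound t; rewrite /lab; lia.
have cardX : #|{: X}| = C.*2.+1.
  by rewrite card_prod cardY -/N /C; have := eN; nia.
pose ar (t : X) := t.2.1.1.1.
pose ro (t : X) := (t.2.1.1.2, r t.1, t.2.1.2).
pose co (t : X) := (t.2.1.1.2, q t.1, t.2.2).
have rowE (V' : nmodType) (F : X -> V') g d p u :
    \sum_(t | (ar t == g) && (ro t == (d, p, u))) F t =
    \sum_(y | r y == p) \sum_v F (y, (g, d, u, v)).
  rewrite pair_big_dep /= (reindex_onto (fun w : Y * V => (w.1, (g, d, u, w.2)))
    (fun t : X => (t.1, t.2.2))) /=.
    apply: eq_bigl => -[y v]; rewrite /ar /ro /= !xpair_eqE !eqxx /= !andbT.
    by [].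
  case=> y [[[g' d'] u'] v]; rewrite /ar /ro /= !xpair_eqE.
  by case/andP=> /eqP-> /andP[/andP[/eqP-> _] /eqP->].
have colE (V' : nmodType) (F : X -> V') g d p v :
    \sum_(t | (ar t == g) && (co t == (d, p, v))) F t =
    \sum_(y | q y == p) \sum_u F (y, (g, d, u, v)).
  rewrite pair_big_dep /= (reindex_onto (fun w : Y * U => (w.1, (g, d, w.2, v)))
    (fun t : X => (t.1, t.2.1.2))) /=.
    apply: eq_bigl => -[y u]; rewrite /ar /co /= !xpair_eqE !eqxx /= !andbT.
    by [].
  case=> y [[[g' d'] u] v']; rewrite /ar /co /= !xpair_eqE.
  by case/andP=> /eqP-> /andP[/andP[/eqP-> _] /eqP->].
have count_row g d p u : #|[pred t | (ar t == g) && (ro t == (d, p, u))]| = (s * #|V|)%N.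
  rewrite -sum1_card (rowE _ (fun=> 1%N)) -(rcard p) -sum1_card.
  by rewrite big_distrl /=; apply: eq_bigr => y _; rewrite sum1_card mul1n.
have count_col g d p v : #|[pred t | (ar t == g) && (co t == (d, p, v))]| = (k * #|U|)%N.
  rewrite -sum1_card (colE _ (fun=> 1%N)) -(ccard p) -sum1_card.
  by rewrite big_distrl /=; apply: eq_bigr => y _; rewrite sum1_card mul1n.
have lab_sum (W : pred X) n : #|W| = n -> \sum_(t | W t) li t = 0 ->
    (\sum_(t | W t) (lab t).+1 = n * C.+1)%N.
  move=> cW sW; apply/eqP; rewrite -(eqr_nat int) natr_sum natrM.
  rewrite (eq_bigr (fun t => li t + C.+1%:R)) => [|t _]; last by have := labE t; lia.
  by rewrite big_split /= sW add0r sumr_const cW mulr_natl.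
apply: (MRS_of_labelling (ar := ar) (ro := ro) (co := co) (lab := lab)
  (x := (s * #|V| * C.+1)%N) (y := (k * #|U| * C.+1)%N)).
- move=> [y1 [[[g1 d1] u1] v1]] [y2 [[[g2 d2] u2] v2]].
  rewrite /ar /ro /co /= => -[-> -> r12 -> _ q12 ->].
  by congr (_, _); apply: rq_inj; congr (_, _).
- move=> t1 t2 e12; have {e12} : li t1 = li t2.
    by have := labE t1; have := labE t2; rewrite e12; lia.
  case: t1 t2 => [y1 z1] [y2 z2]; rewrite /li /= => E.
  have b1 := twist_bound (tau y1) (rank z1).
  have b2 := twist_bound (tau y2) (rank z2).
  (* Low digits are at most [h] in absolute value and [N = 2h + 1], so the two digits can be read
     off the label. *)
  have y12 : y1 = y2 by apply: L_inj; move: E b1 b2; rewrite eN; nia.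
  by move: E; rewrite y12 => /addrI/twist_inj/rank_inj->.
- by move=> t; rewrite cardX; have := labE t; have := li_bound t; lia.
- by move=> g [[d p] u]; apply: count_row.
- by move=> g [[d p] v]; apply: count_col.
- move=> g [[d p] u]; apply: lab_sum; first exact: count_row.
  rewrite rowE exchange_big /=; apply: big1 => v _.
  by rewrite big_split /= -mulr_sumr rsum mulr0 add0r rtw.
- move=> g [[d p] v]; apply: lab_sum; first exact: count_col.
  rewrite colE exchange_big /=; apply: big1 => u _.
  by rewrite big_split /= -mulr_sumr csum mulr0 add0r ctw.
Qed.

(** * Square odd arrays on cyclic diagonals *)

Lemma sum_blocks4 (V : nmodType) (F : nat -> V) a b :
  (forall j, F (a + 4 * j + 0)%N + F (a + 4 * j + 1)%N + F (a + 4 * j + 2)%N +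
     F (a + 4 * j + 3)%N = 0) ->
  \sum_(t < a + 4 * b) F t = \sum_(t < a) F t.
Proof.
move=> F0; elim: b => [|b IH]; first by rewrite muln0 addn0.
have -> : (a + 4 * b.+1 = (a + 4 * b).+4)%N by lia.
rewrite 4!big_ord_recr /= IH -!addrA -[RHS]addr0 -[X in _ = _ + X](F0 b).
by rewrite addn0 addn1 addn2 addn3 -!addrA.
Qed.

Lemma sum_blocks2 (V : nmodType) (F : nat -> V) a n : odd a -> odd n -> (a <= n)%N ->
  (forall j, F (a + 2 * j)%N + F (a + 2 * j + 1)%N = 0) ->
  \sum_(t < n) F t = \sum_(t < a) F t.
Proof.
move=> odda oddn le_an F0; have -> : (n = a + 2 * (n - a)./2)%N.
  by have := odd_double_half (n - a); rewrite oddB // odda oddn; lia.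
elim: (n - a)./2 => [|b IH]; first by rewrite muln0 addn0.
have -> : (a + 2 * b.+1 = (a + 2 * b).+2)%N by lia.
by rewrite 2!big_ord_recr /= IH -addrA -[RHS]addr0 -(F0 b) addn1.
Qed.

(** Three diagonals take the three Kotzig rows; the others, even in number when [e] is odd, take row
    0 with alternating signs. *)
Definition diag_type (t : nat) : bool * nat :=
  if (t < 3)%N then (false, t) else (odd t, 0%N).

Lemma sum_twist_diag_type h (z : 'I_h.*2.+1) e :
  odd e -> (3 <= e)%N -> \sum_(t < e) twist (diag_type t) z = 0.
Proof.
move=> odde e3; rewrite (@sum_blocks2 _ (fun t => twist (diag_type t) z) 3) //.
  by rewrite -[RHS](sum_kotzig z); apply: eq_bigr => t _;
    rewrite /diag_type ltn_ord /twist mul1r.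
move=> j; rewrite /diag_type; have -> : (3 + 2 * j < 3)%N = false by lia.
have -> : (3 + 2 * j + 1 < 3)%N = false by lia.
have -> : odd (3 + 2 * j + 1) = false by lia.
have -> : odd (3 + 2 * j) = true by lia.
by rewrite /twist /= expr0 expr1 mul1r mulN1r addNr.
Qed.

Section Diagonals.
Variable h : nat.
Local Notation Z := 'I_h.*2.+1.
Implicit Types p q : Z.

(* In both sporadic cases each row and each column splits into one Kotzig
   triple and pairs of opposite values; further diagonals come in fours. *)
Definition diag3 (t : nat) q : Z :=
  match t with
  | 0 => q *+ h
  | 1 => q - zhalf
  | 2 => q *+ h + zhalf
  | _ => 0
  end.

Definition diag5 (t : nat) q : Z :=
  match t with
  | 0 => q - zone *+ 2 - zhalf
  | 1 => q *+ h
  | 2 => - (q - zone *+ 2 - zhalf)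
  | 3 => q *+ h + zhalf
  | 4 => q - zhalf
  | _ => 0
  end.

(** In a column, diagonal 0 cancels 1 and 2 cancels 3. Along a row the column index drops by one per
    diagonal, and the shift by [zone *+ 2] makes 0 cancel 2 and 1 cancel 3. *)
Definition diag4 (t : nat) q : Z :=
  match t with
  | 0 => q
  | 1 => - q
  | 2 => - (q + zone *+ 2)
  | _ => q + zone *+ 2
  end.

Definition diag_core (b : bool) t q := if b then diag5 t q else diag3 t q.
Definition core_size (b : bool) := if b then 5%N else 3%N.

Definition diag (b : bool) t q : Z :=
  if (t < core_size b)%N then diag_core b t q else diag4 ((t - core_size b) %% 4) q.

Lemma diag_inj b t : injective (diag b t).
Proof.
have i1 : injective (fun q => q *+ h) := @mulh_inj h.
have i2 (a : Z) : injective (fun q => q *+ h + a) by move=> x y /addIr/i1.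
have i3 (a : Z) : injective (fun q => q + a) by move=> x y /addIr.
have i4 (a c : Z) : injective (fun q => q + a + c) by move=> x y /addIr/addIr.
have i5 (a : Z) : injective (fun q => - (q + a)) by move=> x y /oppr_inj/addIr.
have i6 (a c : Z) : injective (fun q => - (q + a + c)) by move=> x y /oppr_inj/addIr/addIr.
rewrite /diag; case E: (t < core_size b)%N.
  case: b E; case: t => [|[|[|[|[|t]]]]] //= _.
have := ltn_pmod (t - core_size b) (isT : 0 < 4)%N.
case: (_ %% 4)%N => [|[|[|[|]]]] //= _; [exact: inj_id | exact: oppr_inj].
Qed.

Lemma mulh_step q i : (q - zone *+ i) *+ h = q *+ h - zhalf *+ i.
Proof. by rewrite mulrnBl mulrnAC zone_mulh. Qed.

Lemma kotzig_sum3 (x y z : Z) : y = x + zhalf -> z = - (x + x) - zhalf ->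
  cen x + cen z + cen y = 0.
Proof. by move=> -> ->; rewrite addrAC cen_kotzig. Qed.


(** The Kotzig triple starting at [x = q *+ h] ends with [- 2x - zhalf = q - zhalf]. With five
    diagonals it occupies 1, 3 and 4, while 0 and 2 are opposite. *)
Lemma diag_core_col b q : \sum_(t < core_size b) cen (diag_core b t q) = 0.
Proof.
have key : cen (q *+ h) + cen (q - zhalf) + cen (q *+ h + zhalf) = 0.
  by apply: kotzig_sum3 => //; rewrite mulhD opprK.
case: b; rewrite /= !big_ord_recl big_ord0 /= addr0 ?cenN; last by rewrite addrA.
by move: key; lia.
Qed.

Lemma diag_core_row b p : \sum_(t < core_size b) cen (diag_core b t (p - zone *+ t)) = 0.
Proof.
have subD (a c : Z) : (a - c) + (a - c) = (a + a) - (c + c) by rewrite addrACA opprD.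
case: b; rewrite /= !big_ord_recl big_ord0 /= addr0 /bump !leq0n !add1n;
  rewrite ?mulh_step ?mulr1n ?subr0.
  (* Five diagonals: along a row, 2 and 4 are opposite, and 0, 1, 3 form the Kotzig triple. *)
  have E1 : p - zone *+ 4 = p - zone *+ 2 - zone *+ 2.
    by rewrite -addrA -opprD -mulrnDr.
  have E3 : p *+ h - zhalf *+ 3 + zhalf = p *+ h - zhalf - zhalf.
    by rewrite mulrSr opprD addrA addrNK mulr2n opprD addrA.
  have key : cen (p *+ h - zhalf - zhalf) + cen (p - zone *+ 2 - zhalf) +
     cen (p *+ h - zhalf) = 0.
    apply: kotzig_sum3; first by rewrite addrNK.
    by rewrite !subD mulhD !zhalf2 !opprD !opprK addrA.
  by rewrite E1 E3 cenN; lia.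
have E2 : p *+ h - zhalf *+ 2 + zhalf = p *+ h - zhalf.
  by rewrite mulr2n opprD addrA addrNK.
have key : cen (p *+ h - zhalf) + cen (p - zone - zhalf) + cen (p *+ h) = 0.
  apply: kotzig_sum3; first by rewrite addrNK.
  by rewrite !subD mulhD !zhalf2 !opprD !opprK.
by rewrite E2; lia.
Qed.


Lemma diag_tail b i t q : (t < 4)%N -> diag b (core_size b + 4 * i + t) q = diag4 t q.
Proof.
move=> lt_t; rewrite /diag ltnNge -addnA leq_addr /=.
by rewrite addKn mulnC modnMDl modn_small.
Qed.

Lemma sum_diag_col b j q : \sum_(t < core_size b + 4 * j) cen (diag b t q) = 0.
Proof.
rewrite (@sum_blocks4 _ (fun t => cen (diag b t q))) => [|i].
  by rewrite -[RHS](diag_core_col b q); apply: eq_bigr => t _; rewrite /diag ltn_ord.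
rewrite !diag_tail //=.
by rewrite !cenN; lia.
Qed.

Lemma sum_diag_row b j p :
  \sum_(t < core_size b + 4 * j) cen (diag b t (p - zone *+ t)) = 0.
Proof.
rewrite (@sum_blocks4 _ (fun t => cen (diag b t (p - zone *+ t)))) => [|i].
  by rewrite -[RHS](diag_core_row b p); apply: eq_bigr => t _; rewrite /diag ltn_ord.
rewrite !diag_tail //=.
set T := (core_size b + 4 * i)%N.
have E2 : p - zone *+ (T + 2) + zone *+ 2 = p - zone *+ (T + 0).
  by rewrite addn0 mulrnDr opprD [p + _]addrA addrNK.
have E3 : p - zone *+ (T + 3) + zone *+ 2 = p - zone *+ (T + 1).
  by rewrite -[3%N]/(1 + 2)%N addnA [zone *+ (_ + 2)]mulrnDr opprD [p + _]addrA addrNK.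
by rewrite E2 E3 !cenN; lia.
Qed.

End Diagonals.

Lemma sum_centred E : \sum_(t < E.*2.+1) (t%:Z - E%:Z) = 0.
Proof.
have : \sum_(t < E.*2.+1) (t%:Z - E%:Z) = - \sum_(t < E.*2.+1) (t%:Z - E%:Z).
  rewrite -sumrN [LHS](reindex_inj rev_ord_inj); apply: eq_bigr => t _ /=.
  by have := ltn_ord t; lia.
by lia.
Qed.

(** The high digit is the centred index of the diagonal and the low digit comes from [diag]. Every
    row and column meets each of the [e] diagonals once, so both digits sum to 0. *)
Lemma diag_odd_base h e : odd e -> (3 <= e <= h.*2.+1)%N ->
  exists H L tau, @odd_base 'I_h.*2.+1 'I_h.*2.+1 ('I_h.*2.+1 * 'I_e)%type
    (fun y => y.1 + zone *+ y.2) fst e e H L tau.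
Proof.
move=> odde /andP[e3 ed]; pose E := e./2; have eE : e = E.*2.+1.
  by rewrite -[LHS]odd_double_half odde.
(* An odd [e >= 3] is 3 modulo 4, with a core of three diagonals, or 1 modulo 4 and at least 5, with
   a core of five. *)
have [b [j ej]] : exists b j, e = (core_size b + 4 * j)%N.
  have := odd_double_half E; case: (odd E) => EE.
    exists false, (E./2); rewrite eE /=; lia.
  by exists true, (E./2.-1); rewrite eE /=; lia.
have rowS (p : 'I_h.*2.+1) : \sum_(t < e) cen (diag b t (p - zone *+ t)) = 0.
  by rewrite ej sum_diag_row.
have colS (q : 'I_h.*2.+1) : \sum_(t < e) cen (diag b t q) = 0.
  by rewrite ej sum_diag_col.
have rowE (V : nmodType) (F : 'I_h.*2.+1 * 'I_e -> V) p :
    \sum_(y : 'I_h.*2.+1 * 'I_e | y.1 + zone *+ y.2 == p) F y = \sum_(t < e) F (p - zone *+ t, t).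
  rewrite (reindex_onto (fun t : 'I_e => (p - zone *+ t, t)) snd) => [|[q t] /eqP <-] /=.
    by apply: eq_bigl => t; rewrite addrNK !eqxx.
  by rewrite addrK.
have colE (V : nmodType) (F : 'I_h.*2.+1 * 'I_e -> V) q :
    \sum_(y : 'I_h.*2.+1 * 'I_e | y.1 == q) F y = \sum_t F (q, t).
  rewrite (reindex_onto (fun t : 'I_e => (q, t)) snd) => [|[q' t] /eqP <-] //=.
  by apply: eq_bigl => t; rewrite !eqxx.
exists (h.*2.+1 * E + h)%N.
exists (fun y : 'I_h.*2.+1 * 'I_e => h.*2.+1%:Z * (y.2%:Z - E%:Z) + cen (diag b y.2 y.1)).
exists (fun y : 'I_h.*2.+1 * 'I_e => diag_type y.2).
have sumA : \sum_(t < e) (h.*2.+1%:Z * (t%:Z - E%:Z)) = 0.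
  by rewrite -mulr_sumr; have := sum_centred E; rewrite -eE => ->; rewrite mulr0.
split.
- move=> [q t] [q' t'] Ep; have {Ep} [E1 E2] : q + zone *+ t = q' + zone *+ t' /\ q = q'.
    by split; [apply: (congr1 fst Ep) | apply: (congr1 snd Ep)].
  congr (_, _) => //; apply: val_inj => /=.
  move: E1; rewrite E2 => /addrI E1; have := val_mul_zone h.*2 t; rewrite E1 val_mul_zone.
  by rewrite !modn_small // (leq_trans (ltn_ord _)).
- by move=> p; rewrite -sum1_card rowE sum1_card card_ord.
- by move=> p; rewrite -sum1_card colE sum1_card card_ord.
- by rewrite card_prod !card_ord eE; nia.
- move=> [q t] [q' t'] /= E12.
  have b1 := cen_bound (diag b t q); have b2 := cen_bound (diag b t' q').
  have tt' : t = t' by apply: val_inj => /=; move: b1 b2 E12; nia.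
  by move: E12; rewrite tt' => /addrI/cen_inj/diag_inj ->.
- move=> [q t] /=; have b1 := cen_bound (diag b t q).
  by have := ltn_ord t; rewrite {2}eE; nia.
- by move=> p; rewrite rowE big_split /= sumA add0r rowS.
- by move=> p; rewrite colE big_split /= sumA add0r colS.
- by move=> f z p; rewrite rowE sum_twist_diag_type.
- by move=> f z p; rewrite colE sum_twist_diag_type.
Qed.

(** * Low-digit types for full odd rectangles *)

Definition rect_type (i j : nat) : bool * nat :=
  if (i < 3)%N then if (j < 3)%N then (false, (i + j) %% 3)%N else (odd j, i)
  else if (j < 3)%N then (odd i, j) else (odd (i + j), 0%N).

Lemma rect_typeC i j : rect_type i j = rect_type j i.
Proof. by rewrite /rect_type addnC; do 2 case: ifP. Qed.

(** The first three cells of every row use all three Kotzig rows with a common sign: for [i < 3]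
    they are a row of the cyclic Latin square. The remaining cells cancel in consecutive pairs.
    Columns follow by the symmetry [rect_typeC]. *)
Lemma sum_twist_rect_type h (z : 'I_h.*2.+1) i s :
  odd s -> (3 <= s)%N -> \sum_(j < s) twist (rect_type i j) z = 0.
Proof.
move=> odds s3; have K := sum_kotzig z; rewrite !big_ord_recr big_ord0 /= add0r in K.
rewrite (@sum_blocks2 _ (fun j => twist (rect_type i j) z) 3) //; last first.
  move=> j; rewrite /rect_type; have -> : (3 + 2 * j < 3)%N = false by lia.
  have -> : (3 + 2 * j + 1 < 3)%N = false by lia.
  have -> : odd (3 + 2 * j + 1) = false by lia.
  have -> : odd (3 + 2 * j) = true by lia.
  have -> : odd (i + (3 + 2 * j + 1)) = odd i by lia.
  have -> : odd (i + (3 + 2 * j)) = ~~ odd i by lia.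
  by case: ifP => _; rewrite /twist /=; [|case: (odd i)];
    rewrite /= expr0 expr1 mul1r mulN1r ?subrr ?addNr.
rewrite !big_ord_recr big_ord0 /= add0r /rect_type /twist.
case: ifP => [|_] /=.
  by case: i => [|[|[|//]]] _ /=; rewrite !mul1r; move: K; rewrite /modn /=; lia.
by case: (odd i); rewrite /= ?expr0 ?expr1 ?mulN1r ?mul1r; move: K => /=; lia.
Qed.

(** A classical magic rectangle translated to have line sums 0: for odd [k * s] the bound leaves
    exactly [k * s] possible values. *)
Definition zero_rect k s := exists L : 'I_k * 'I_s -> int,
  [/\ injective L, forall y, `|L y| <= ((k * s)%N./2)%:Z,
      forall i, \sum_j L (i, j) = 0 & forall j, \sum_i L (i, j) = 0].

Lemma rect_odd_base k s : odd k -> odd s -> (3 <= k)%N -> (3 <= s)%N ->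
  zero_rect k s ->
  exists H L tau, @odd_base 'I_k 'I_s ('I_k * 'I_s)%type fst snd s k H L tau.
Proof.
move=> oddk odds k3 s3 [L [L_inj L_bound rsum csum]].
have rowE (V : nmodType) (F : 'I_k * 'I_s -> V) i :
    \sum_(y : 'I_k * 'I_s | y.1 == i) F y = \sum_j F (i, j).
  rewrite (reindex_onto (fun j : 'I_s => (i, j)) snd) => [|[i' j] /eqP <-] //=.
  by apply: eq_bigl => j; rewrite !eqxx.
have colE (V : nmodType) (F : 'I_k * 'I_s -> V) j :
    \sum_(y : 'I_k * 'I_s | y.2 == j) F y = \sum_i F (i, j).
  rewrite (reindex_onto (fun i : 'I_k => (i, j)) fst) => [|[i j'] /eqP <-] //=.
  by apply: eq_bigl => i; rewrite !eqxx.
exists (k * s)%N./2, L, (fun y : 'I_k * 'I_s => rect_type y.1 y.2); split=> //.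
- by move=> [i j] [i' j'].
- by move=> p; rewrite -sum1_card rowE sum1_card card_ord.
- by move=> p; rewrite -sum1_card colE sum1_card card_ord.
- by rewrite card_prod !card_ord -[LHS]odd_double_half oddM oddk odds.
- by move=> i; rewrite rowE.
- by move=> j; rewrite colE.
- by move=> f z i; rewrite rowE sum_twist_rect_type.
- move=> f z j; rewrite colE -[RHS](sum_twist_rect_type z j oddk k3).
  by apply: eq_bigr => i _; rewrite rect_typeC.
Qed.

(** * Odd rectangles *)

Section Rectangle.
Variables K S : nat.
Local Notation Zk := 'I_K.*2.+1.
Local Notation Zs := 'I_S.*2.+1.
Hypotheses (K_gt0 : (0 < K)%N) (S_gt1 : (1 < S)%N).
Variables (J : {set Zs}) (z : Zs) (rho : Zs -> Zs).
Let p : Zs := - zhalf.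
Hypotheses (z_neg : (S < z)%N) (zNp : z != p).
Hypotheses (J0 : 0 \notin J) (Jp : p \notin J) (Jz : z \notin J).
Hypothesis card_J : #|J| = S.-1.
Hypothesis sum_J : \sum_(f in J) (cen (- (f + f) - zhalf) - cen f) = 0.
Hypotheses (rho_inj : injective rho).
Hypotheses (rho0 : cen (rho 0) = - S%:Z) (rhop : cen (rho p) = S%:Z).
Hypothesis rhoz : cen (rho z) = 0.
Hypothesis sum_rho : \sum_(f in J) cen (rho f) = 0.

Let J' : {set Zs} := ~: (J :|: [set 0; p; z]).

(* [u] is the row and [f] the column of a cell. Its high digit is [cen (v *+ K)]
   for [v = rect_band u f]: the columns [0], [p], [z] together carry a Kotzig
   triple, those of [J] and [J'] opposite values. Its low digit is
   [rect_digit v f]: again a Kotzig triple for [v] among [0], [zone], [- zone],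
   and opposite values otherwise. *)
Definition rect_digit (v : Zk) (f : Zs) : Zs :=
  if v == 0 then f + zhalf
  else if v == zone then - (f + f) - zhalf
  else if v == - zone then f
  else if (v <= K)%N then rho f else - rho f.

(** The three special columns leave a digit defect in row [- zone], whereas doubling in [J] and [J']
    puts the opposite defect at [- zhalf]. The transposition brings both into one row; the defects
    at 0 and [zhalf] already match. *)
Definition rect_swap (u : Zk) : Zk := tperm (- zone) (- zhalf) u.

Definition rect_band (u : Zk) (f : Zs) : Zk :=
  if f == 0 then u
  else if f == p then u + zone
  else if f == z then - (u + u) - zone
  else if f \in J then - (rect_swap u + rect_swap u)
  else rect_swap u + rect_swap u.

Definition rect_label (y : Zk * Zs) : int :=
  S.*2.+1%:Z * cen (rect_band y.1 y.2 *+ K) + cen (rect_digit (rect_band y.1 y.2) y.2).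

Lemma rect_digit_inj v : injective (rect_digit v).
Proof.
rewrite /rect_digit => f g; case: ifP => _; first by move=> /addIr.
case: ifP => _; first by move=> /addIr/oppr_inj/addZZ_inj.
case: ifP => _ //.
by case: ifP => _; [|move/oppr_inj]; move/rho_inj.
Qed.

Lemma rect_band_inj f : injective (rect_band^~ f).
Proof.
rewrite /rect_band => u v; case: ifP => // _; case: ifP => _; first exact: addIr.
case: ifP => _; first by move=> /addIr/oppr_inj/addZZ_inj.
by case: ifP => _; [move/oppr_inj|]; move=> /addZZ_inj/perm_inj.
Qed.

Lemma val_zone : (zone : Zk) = 1%N :> nat.
Proof. by rewrite /= modn_small //; lia. Qed.

Lemma val_Nzone : (- zone : Zk) = K.*2 :> nat.
Proof. by rewrite val_oppZ val_zone /=; lia. Qed.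

Lemma zk_neq : [/\ (zone : Zk) != 0, (- zone : Zk) != 0 & - zone != zone :> Zk].
Proof.
have [v1 v2] := (val_zone, val_Nzone).
by split; apply/eqP => /(congr1 (@nat_of_ord _)); rewrite ?v1 ?v2 /=; lia.
Qed.

Lemma val_Nzhalf : p = S.+1 :> nat.
Proof. by rewrite val_oppZ val_zhalf; case: eqP; lia. Qed.

Lemma cen_p : cen p = - S%:Z.
Proof. by rewrite cenN /cen val_zhalf leqnn. Qed.

Lemma p_neq0 : p != 0.
Proof. by apply/eqP => /(congr1 (@nat_of_ord _)); rewrite val_Nzhalf. Qed.

Lemma z_neq0 : z != 0.
Proof. by apply/eqP => E; move: z_neg; rewrite E. Qed.

Lemma sum_split (F : Zs -> int) :
  \sum_f F f = F 0 + F p + F z + \sum_(f in J) F f + \sum_(f in J') F f.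
Proof.
rewrite (bigD1 0) //= (bigD1 p) ?p_neq0 //= (bigD1 z) ?z_neq0 ?zNp //= (bigID (mem J)) /=.
rewrite !addrA; congr (_ + _ + _); apply: eq_bigl => f; rewrite ?inE.
  have [fJ|] := boolP (f \in J); rewrite ?andbF // !andbT.
  by rewrite (memPn J0) // (memPn Jp) // (memPn Jz).
by rewrite !negb_or andbC; case: (f \in J); rewrite //= andbA.
Qed.

Lemma card_J' : #|J'| = S.-1.
Proof.
have := sum_split (fun=> 1); rewrite !sumr_const card_J card_ord.
by rewrite !(natz, mulr_natr) => E; move: E S_gt1; lia.
Qed.

Lemma sum_rho' : \sum_(f in J') cen (rho f) = 0.
Proof.
have := sum_split (fun f => cen (rho f)); rewrite sum_rho rho0 rhop rhoz.
have -> : \sum_(f : Zs) cen (rho f) = 0; last by lia.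
by rewrite -[RHS](@sum_cen S) [RHS](reindex_inj rho_inj).
Qed.

Lemma sum_J_values : \sum_(f in J') cen f = S%:Z - cen z - \sum_(f in J) cen f.
Proof. by have := sum_split (@cen S); rewrite sum_cen cen_p cen0; lia. Qed.

Lemma cen_z_half : cen (z + zhalf) = cen z + S%:Z.
Proof.
rewrite /cen val_addZ val_zhalf; have ltz := ltn_ord z.
by case: (ltnP (z + S)) => ?; do 2 case: leqP => ?; lia.
Qed.

Lemma cen_second (f : Zs) : cen (- (f + f) - zhalf) = - cen f - cen (f + zhalf).
Proof. by have := cen_kotzig f; lia. Qed.

Lemma sum_shift : \sum_(f : Zs) cen (f + zhalf) = 0.
Proof. by rewrite -[RHS](@sum_cen S) [RHS](reindex_inj (addIr zhalf)). Qed.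

(* The three values of [w] on which the columns of [J] and [J'] do not cancel
   are compensated by the three remaining columns, see [rect_special]. *)
Lemma sum_digit (w : Zk) :
  \sum_(f in J) cen (rect_digit w f) + \sum_(f in J') cen (rect_digit (- w) f) =
  if w == 0 then - S%:Z *+ 2 - cen z
  else if w == zone then S%:Z - cen z
  else if w == - zone then S%:Z + cen z *+ 2
  else 0.
Proof.
have [z1 z2 z3] := zk_neq.
have sJ : \sum_(f in J) cen (- (f + f) - zhalf) = \sum_(f in J) cen f.
  by apply/eqP; rewrite -subr_eq0 -sumrB sum_J.
have tot := sum_split (fun f : Zs => cen (f + zhalf)).
have sY' : \sum_(f in J') cen (- (f + f) - zhalf) =
    - \sum_(f in J') cen f - \sum_(f in J') cen (f + zhalf).
  by rewrite -sumrN -sumrB; apply: eq_bigr => f _; rewrite cen_second.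
have sY : \sum_(f in J) cen (- (f + f) - zhalf) =
    - \sum_(f in J) cen f - \sum_(f in J) cen (f + zhalf).
  by rewrite -sumrN -sumrB; apply: eq_bigr => f _; rewrite cen_second.
move: tot; rewrite sum_shift add0r cen_z_half addNr cen0.
have -> : cen (zhalf : Zs) = S%:Z by rewrite /cen val_zhalf leqnn.
move=> tot; have sJ' := sum_J_values.
rewrite /rect_digit oppr_eq0; case: (eqVneq w 0) => [_|w0]; cbv match.
  by clear -tot sJ'; lia.
rewrite eqr_oppLR; case: (eqVneq w zone) => [->|w1]; cbv match.
  by rewrite eq_sym (negbTE z3) eqxx; cbv match; clear -sJ sJ'; lia.
rewrite eqr_opp (negbTE w1).
case: (eqVneq w (- zone)) => [_|w2]; cbv match; first by clear -sJ sJ' sY sY' tot; lia.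
rewrite (_ : (- w <= K)%N = ~~ (w <= K)%N); last first.
  have nw : (w : nat) != 0%N by apply: contra w0 => /eqP E; apply/eqP/val_inj.
  by rewrite val_oppZ (negbTE nw); have := ltn_ord w; clear; lia.
case: (w <= K)%N; cbv match.
  by under [X in _ + X]eq_bigr do rewrite cenN; rewrite sumrN sum_rho sum_rho' oppr0 addr0.
by under eq_bigr do rewrite cenN; rewrite sumrN sum_rho sum_rho' oppr0 addr0.
Qed.

Lemma rect_digit_0 v : cen (rect_digit v 0) =
  if v == 0 then S%:Z else if v == - zone then 0 else if (v <= K)%N then - S%:Z else S%:Z.
Proof.
have [z1 z2 z3] := zk_neq.
have cS : cen (zhalf : Zs) = S%:Z by rewrite /cen val_zhalf leqnn.
rewrite /rect_digit !addr0 oppr0 !add0r; case: eqP => // _.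
case: (eqVneq v zone) => [->|_].
  by rewrite eq_sym (negbTE z3) val_zone K_gt0 cenN cS.
by case: eqP => // _; case: ifP; rewrite ?cenN rho0 ?opprK.
Qed.

Lemma rect_digit_p v : cen (rect_digit v p) =
  if v == 0 then 0 else if (v <= K)%N then S%:Z else - S%:Z.
Proof.
have [z1 z2 z3] := zk_neq.
have cS : cen (zhalf : Zs) = S%:Z by rewrite /cen val_zhalf leqnn.
rewrite /rect_digit; case: eqP => [_|_]; first by rewrite addNr.
case: (eqVneq v zone) => [->|_].
  by rewrite val_zone K_gt0 cen_second addNr cen0 cen_p subr0 opprK.
case: (eqVneq v (- zone)) => [->|_]; last by case: ifP; rewrite ?cenN rhop.
by rewrite val_Nzone cen_p; case: leqP => //; lia.
Qed.

Lemma rect_digit_z v : cen (rect_digit v z) =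
  if v == 0 then cen z + S%:Z else if v == zone then - S%:Z - cen z *+ 2
  else if v == - zone then cen z else 0.
Proof.
rewrite /rect_digit; case: eqP => _; first exact: cen_z_half.
case: eqP => _; first by rewrite cen_second cen_z_half; lia.
by case: eqP => // _; case: ifP; rewrite ?cenN rhoz ?oppr0.
Qed.

(** In general [u] and [u + zone] lie in the same half, so columns [0] and [p] carry opposite digits
    of size [S] and column [z] carries 0. The exceptions are the rows where the band of column [z]
    is [- zone], 0 or [zone], namely [u = 0], [zhalf], [- zone]. *)
Lemma rect_special u :
  cen (rect_digit u 0) + cen (rect_digit (u + zone) p) + cen (rect_digit (- (u + u) - zone) z) =
  if u == 0 then S%:Z *+ 2 + cen z
  else if u == zhalf then cen z - S%:Z
  else if u == - zone then - S%:Z - cen z *+ 2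
  else 0.
Proof.
have [z1 z2 z3] := zk_neq.
have vK : (zhalf : Zk) = K :> nat := val_zhalf K.
have vK' : (- zhalf : Zk) = K.+1 :> nat.
  by rewrite val_oppZ vK; case: eqP; lia.
rewrite rect_digit_0 rect_digit_p rect_digit_z.
case: (eqVneq u 0) => [->|u0].
  rewrite addr0 oppr0 !add0r (negbTE z1) (negbTE z2) (negbTE z3) eqxx val_zone K_gt0.
  by lia.
case: (eqVneq u zhalf) => [->|uh].
  have -> : zhalf + zone = - zhalf :> Zk by rewrite -[zone]opprK -zhalf2 opprD addNKr.
  have -> : - (zhalf + zhalf) - zone = 0 :> Zk by rewrite zhalf2 opprK subrr.
  rewrite eqxx oppr_eq0 vK vK' leqnn ltnn.
  have -> : zhalf == 0 :> Zk = false by apply/eqP => /(congr1 (@nat_of_ord _)); rewrite vK /=; lia.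
  have -> : zhalf == - zone :> Zk = false.
    by apply/eqP => /(congr1 (@nat_of_ord _)); rewrite vK val_Nzone; lia.
  by lia.
case: (eqVneq u (- zone)) => [->|un].
  rewrite addNr eqxx opprD !opprK addrK (negbTE z1) eqxx.
  by lia.
have w1 : - (u + u) - zone != 0.
  rewrite -opprD oppr_eq0 addr_eq0 -zhalf2.
  by apply: contra uh => /eqP/addZZ_inj ->.
have w2 : - (u + u) - zone != zone.
  rewrite subr_eq eqr_oppLR; apply: contra un => /eqP E.
  by apply/eqP/addZZ_inj; rewrite E opprD.
have w3 : - (u + u) - zone != - zone.
  rewrite -subr_eq0 addrK oppr_eq0; apply: contra u0 => /eqP E.
  by apply/eqP/addZZ_inj; rewrite E addr0.
rewrite (negbTE w1) (negbTE w2) (negbTE w3) addr0.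
have nv (a : Zk) : u != a -> (u : nat) != a by apply: contra => /eqP E; apply/eqP/val_inj.
have := nv _ uh; rewrite vK => uK; have := nv _ un; rewrite val_Nzone => uK2.
have u1 : u + zone != 0 by rewrite addr_eq0.
rewrite (negbTE u1) val_addZ val_zone; have ltu := ltn_ord u.
have e1 : (u + 1 < K.*2.+1)%N by clear -ltu uK2; lia.
have e2 : (u + 1 <= K)%N = (u <= K)%N by clear -uK; lia.
rewrite e1 e2.
by case: (u <= K)%N; rewrite ?addNr ?subrr.
Qed.

Lemma rect_bandE u :
  [/\ rect_band u 0 = u, rect_band u p = u + zone, rect_band u z = - (u + u) - zone,
   {in J, forall f, rect_band u f = - (rect_swap u + rect_swap u)} &
   {in J', forall f, rect_band u f = rect_swap u + rect_swap u}].
Proof.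
rewrite /rect_band eqxx (negbTE p_neq0) eqxx (negbTE z_neq0) (negbTE zNp) eqxx.
split=> // f.
  move=> fJ; rewrite fJ; have := memPn J0 _ fJ; have := memPn Jp _ fJ.
  by have := memPn Jz _ fJ; do 3 move=> /negbTE ->.
by rewrite !inE !negb_or -!andbA => /and4P[/negbTE-> /negbTE-> /negbTE-> /negbTE->].
Qed.

(** Multiplying by [K], that is by minus one half, turns the bands of the three special columns into
    the Kotzig triple of [u *+ K], and those of [J] and [J'] into [g] and [- g]. The sets [J] and
    [J'] have equal size. *)
Lemma rect_row_band u : \sum_f cen (rect_band u f *+ K) = 0.
Proof.
have [E0 Ep Ez EJ EJ'] := rect_bandE u; set g := rect_swap u in EJ EJ'.
have gK : (g + g) *+ K = - g by rewrite mulrnDl mulhD.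
rewrite sum_split E0 Ep Ez.
rewrite (eq_bigr (fun=> cen g)) => [|f fJ]; last by rewrite EJ // mulNrn gK opprK.
rewrite (eq_bigr (fun=> cen (- g)) (P := mem J')) => [|f fJ]; last by rewrite EJ' // gK.
rewrite !sumr_const card_J card_J' cenN mulNrn -addrA subrr addr0.
rewrite !mulrnDl !mulNrn zone_mulh -(cen_kotzig (u *+ K)) mulrnDl.
by [].
Qed.

Lemma rect_row_digit u : \sum_f cen (rect_digit (rect_band u f) f) = 0.
Proof.
have [E0 Ep Ez EJ EJ'] := rect_bandE u; set g := rect_swap u in EJ EJ'.
rewrite sum_split E0 Ep Ez.
rewrite (eq_bigr (fun f => cen (rect_digit (- (g + g)) f))) => [|f fJ]; last by rewrite EJ.
rewrite (eq_bigr (fun f => cen (rect_digit (- - (g + g)) f)) (P := mem J')) => [|f fJ]; last first.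
  by rewrite opprK EJ'.
rewrite -addrA sum_digit rect_special.
have [z1 z2 z3] := zk_neq.
have vK : (zhalf : Zk) = K :> nat := val_zhalf K.
have h0 : zhalf != 0 :> Zk by apply/eqP => /(congr1 (@nat_of_ord _)); rewrite vK /=; lia.
have hN1 : zhalf != - zone :> Zk.
  by apply/eqP => /(congr1 (@nat_of_ord _)); rewrite vK val_Nzone; lia.
have hNh : zhalf != - zhalf :> Zk.
  by rewrite -subr_eq0 opprK zhalf2.
have dbl (a b : Zk) : a + a = b -> (- (g + g) == - b) = (g == a).
  by move=> <-; rewrite eqr_opp; apply/eqP/eqP => [/addZZ_inj|->].
have d0 : (- (g + g) == 0) = (g == 0) by rewrite -(dbl 0 0) ?oppr0 ?addr0.
have d1 : (- (g + g) == zone) = (g == zhalf) by rewrite -(dbl zhalf _ (zhalf2 _)) opprK.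
have d2 : (- (g + g) == - zone) = (g == - zhalf).
  by rewrite -(dbl (- zhalf) zone) // -opprD zhalf2 opprK.
pose t := tperm (- zone : Zk) (- zhalf).
have t0 : t 0 = 0 by rewrite tpermD // oppr_eq0.
have t1 : t zhalf = zhalf by rewrite tpermD // eq_sym.
have t2 : t (- zone) = - zhalf by rewrite tpermL.
have s0 : (g == 0) = (u == 0) by rewrite -{1}t0 (inj_eq perm_inj).
have s1 : (g == zhalf) = (u == zhalf) by rewrite -{1}t1 (inj_eq perm_inj).
have s2 : (g == - zhalf) = (u == - zone) by rewrite -{1}t2 (inj_eq perm_inj).
rewrite d0 d1 d2 s0 s1 s2; clear.
case: (u == 0); [|case: (u == zhalf); [|case: (u == - zone)]]; cbv match; by lia.
Qed.

Lemma rect_col_band f : \sum_u cen (rect_band u f *+ K) = 0.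
Proof.
rewrite -[RHS](@sum_cen K) [RHS](reindex_inj (inj_comp (@mulh_inj K) (@rect_band_inj f))).
by [].
Qed.

(** Down a column the band takes every value once. The bands 0, [zone], [- zone] give the Kotzig
    triple of [f], and any other [v] cancels [- v], whence [T = - T]. *)
Lemma rect_col_digit f : \sum_u cen (rect_digit (rect_band u f) f) = 0.
Proof.
have [z1 z2 z3] := zk_neq.
transitivity (\sum_v cen (rect_digit v f)).
  by rewrite [RHS](reindex_inj (@rect_band_inj f)).
rewrite (bigD1 0) //= (bigD1 zone) //= (bigD1 (- zone)) /=; last by rewrite z2.
set T := \sum_(v | _) _.
have T0 : T = - T.
  rewrite /T -sumrN [LHS](reindex_inj oppr_inj) /=.
  have neg v : [&& - v != 0, - v != zone & - v != - zone] = [&& v != 0, v != zone & v != - zone].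
    by rewrite oppr_eq0 eqr_oppLR eqr_opp [(v != - _) && _]andbC.
  apply: eq_big => [v|v]; first by rewrite -!andbA neg.
  rewrite -andbA neg /rect_digit oppr_eq0 eqr_oppLR eqr_opp => /and3P[v0 v1 v2].
  rewrite (negbTE v0) (negbTE v1) (negbTE v2).
  have nv : (v : nat) != 0%N by apply: contra v0 => /eqP E; apply/eqP/val_inj.
  have -> : (- v <= K)%N = ~~ (v <= K)%N.
    by rewrite val_oppZ (negbTE nv); have := ltn_ord v; clear; lia.
  by case: (v <= K)%N; rewrite cenN ?opprK.
rewrite /rect_digit !eqxx (negbTE z1) (negbTE z2) (negbTE z3).
have -> : T = 0 by move: T0; clear; lia.
by rewrite cen_second; move: (cen (f + _)) (cen f); clear => a b; lia.
Qed.

Lemma rect_zero_rect : zero_rect K.*2.+1 S.*2.+1.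
Proof.
exists rect_label; split.
- move=> [u f] [u' f']; rewrite /rect_label /= => E.
  set v := rect_band u f in E; set v' := rect_band u' f' in E.
  have b1 := cen_bound (rect_digit v f); have b2 := cen_bound (rect_digit v' f').
  have vv : v = v'.
    by apply/mulh_inj/cen_inj; move: E b1 b2; clear; nia.
  move: E; rewrite vv => /addrI/cen_inj/rect_digit_inj ff.
  by congr (_, _) => //; apply: (@rect_band_inj f); rewrite -/v vv ff.
- move=> y; rewrite /rect_label; move: (rect_band y.1 y.2) => v.
  have b1 := cen_bound (rect_digit v y.2); have b2 := cen_bound (v *+ K).
  have -> : ((K.*2.+1 * S.*2.+1)./2 = S.*2.+1 * K + S)%N by clear; lia.
  by move: b1 b2; clear; nia.
- by move=> u; rewrite big_split /= -mulr_sumr rect_row_band rect_row_digit mulr0.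
- by move=> f; rewrite big_split /= -mulr_sumr rect_col_band rect_col_digit mulr0.
Qed.

End Rectangle.

(** * Choice of the column sets for odd rectangles *)

(** Greedy choice: the largest number is left out if the others can still reach [t], and taken
    otherwise. The inequalities place [t] between the sums of the [m] smallest and the [m] largest
    numbers. *)
Lemma subset_of_sum n m t : (m <= n)%N -> (m * m.+1 <= 2 * t)%N ->
  (2 * t + m * m <= m * (2 * n).+1)%N ->
  exists s : seq nat, [/\ uniq s, {in s, forall i, (0 < i <= n)%N}, size s = m & sumn s = t].
Proof.
elim: n m t => [|n IH] m t le_mn lo hi.
  exists [::]; split=> //=; first by lia.
  by move: lo hi le_mn; rewrite leqn0 => lo hi /eqP m0; move: hi; rewrite m0; lia.
have [/andP[le_m hi']|] := boolP ((m <= n) && (2 * t + m * m <= m * (2 * n).+1))%N.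
  have [s [us sn sm st]] := IH m t le_m lo hi'.
  by exists s; split=> // i /sn; lia.
move=> h; case: m le_mn lo hi h => [|m] le_mn lo hi h.
  by move: h hi; rewrite !mul0n; lia.
have [u et lo'] : exists2 u, t = (u + n.+1)%N & (m * m.+1 <= 2 * u)%N.
  have [c ec] : exists c, (m * m.+1 = 2 * c)%N.
    by exists (m * m.+1)./2; rewrite -[LHS]odd_double_half oddM /= andbN mul2n.
  have [eq_mn|[d ed]] : m = n \/ exists d, n = (m + d.+1)%N.
    by case: (eqVneq m n) => [|ne]; [left|right; exists (n - m).-1; lia].
    by exists (t - n.+1)%N; subst m; nia.
  move: h; rewrite negb_and -!ltnNge => /orP[h|h]; first by lia.
  subst n; exists (t - (m + d.+1).+1)%N.
    have : (0 <= m * d)%N by [].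
    nia.
  nia.
have le_m : (m <= n)%N by lia.
subst t.
have hi2 : (2 * u + m * m <= m * (2 * n).+1)%N by nia.
have [s [us sn sm st]] := IH m _ le_m lo' hi2.
exists (n.+1 :: s); split=> /=.
- by rewrite us andbT; apply/negP => /sn; lia.
- by move=> i; rewrite inE => /orP[/eqP->|/sn]; lia.
- by rewrite sm.
- by rewrite st; lia.
Qed.

(** [Q] and [N] are to be the absolute values of the positive and negative columns in [J]; the
    equation is then [sum_J], through [second_sub_first]. [N] avoids [S] because [p] represents
    [- S], and its size leaves room for [z]. *)
Lemma balanced_choice S : (4 <= S)%N -> exists N Q : seq nat,
  [/\ uniq N, uniq Q, {in N, forall i, (0 < i < S)%N}, {in Q, forall i, (0 < i <= S)%N} &
   [/\ (size N + size Q = S.-1)%N, (size N < S.-1)%N &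
    (3 * sumn N + size Q * S.+1 = 3 * sumn Q + size N * S)%N]].
Proof.
move=> S4.
suff [n1 [n2 [sN [sQ [h1 h2 h3 [a1 a2 a3] [b1 b2 b3]]]]]] : exists n1 n2 sN sQ : nat,
    [/\ (n1 + n2 = S.-1)%N, (n1 < S.-1)%N, (3 * sN + n2 * S.+1 = 3 * sQ + n1 * S)%N,
     [/\ n1 <= S.-1, n1 * n1.+1 <= 2 * sN & 2 * sN + n1 * n1 <= n1 * (2 * S.-1).+1]%N &
     [/\ n2 <= S, n2 * n2.+1 <= 2 * sQ & 2 * sQ + n2 * n2 <= n2 * (2 * S).+1]%N].
  have [N [uN iN zN tN]] := subset_of_sum a1 a2 a3.
  have [Q [uQ iQ zQ tQ]] := subset_of_sum b1 b2 b3.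
  exists N, Q; split=> //; first by move=> i /iN; lia.
  by rewrite zN zQ tN tQ.
(* Modulo 3 the balance only constrains the sizes. Sizes near [S / 2] that satisfy it, with sums in
   the admissible range, are listed by the residue of [S] modulo 6. *)
have eS : S = (6 * (S %/ 6) + S %% 6)%N by lia.
have : (S %% 6 < 6)%N by rewrite ltn_mod.
move: (S %/ 6)%N (S %% 6)%N eS => b [|[|[|[|[|[|//]]]]]] eS _.
- by exists (3 * b - 1)%N, (3 * b)%N, ((3 * b - 1) * (3 * b))%N, (9 * b * b)%N;
    split; [lia|lia|nia|split; nia|split; nia].
- by exists (3 * b)%N, (3 * b)%N, (3 * b * (3 * b + 1))%N, (9 * b * b + 4 * b)%N;
    split; [lia|lia|nia|split; nia|split; nia].
- by exists (3 * b)%N, (3 * b + 1)%N, (3 * b * (3 * b + 1))%N, ((3 * b + 1) * (3 * b + 1))%N;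
    split; [lia|lia|nia|split; nia|split; nia].
- by exists (3 * b + 2)%N, (3 * b)%N, (9 * b * b + 6 * b + 2)%N, (3 * b * (3 * b + 1))%N;
    split; [lia|lia|nia|split; nia|split; nia].
- by exists (3 * b + 1)%N, (3 * b + 2)%N, ((3 * b + 1) * (3 * b + 2))%N, ((3 * b + 2) * (3 * b + 2))%N;
    split; [lia|lia|nia|split; nia|split; nia].
- by exists (3 * b + 3)%N, (3 * b + 1)%N, (9 * b * b + 15 * b + 6)%N, ((3 * b + 1) * (3 * b + 3))%N;
    split; [lia|lia|nia|split; nia|split; nia].
Qed.

Section SignedSets.
Variable S : nat.
Local Notation Z := 'I_S.*2.+1.
Variables Q N : seq nat.
Hypotheses (iQ : {in Q, forall i, (0 < i <= S)%N}) (iN : {in N, forall i, (0 < i <= S)%N}).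

Lemma cen_inZp i : (i <= S)%N -> cen (inZp i : Z) = i%:Z.
Proof. by move=> le_i; rewrite /cen /= modn_small ?le_i //; lia. Qed.

Let elems : seq Z := [seq inZp i | i <- Q] ++ [seq - inZp i | i <- N].
Definition signed_set : {set Z} := [set f in elems].

Lemma signed_setP f : f \in signed_set ->
  (exists2 i, i \in Q & cen f = i%:Z) \/ (exists2 i, i \in N & cen f = - i%:Z).
Proof.
rewrite inE mem_cat => /orP[] /mapP[i i_in ->]; [left|right]; exists i => //.
  by rewrite cen_inZp //; have /andP[] := iQ i_in.
by rewrite cenN cen_inZp //; have /andP[] := iN i_in.
Qed.

Hypotheses (uQ : uniq Q) (uN : uniq N).

Lemma uniq_elems : uniq elems.
Proof.
rewrite cat_uniq; apply/and3P; split.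
- rewrite map_inj_in_uniq // => i j /iQ/andP[_ iS] /iQ/andP[_ jS] /(congr1 (@cen S)).
  by rewrite !cen_inZp // => -[].
- apply/hasPn => f /mapP[i /iN/andP[i0 iS] ->]; apply/mapP => -[j /iQ/andP[j0 jS]].
  by move=> /(congr1 (@cen S)); rewrite cenN !cen_inZp //; lia.
- rewrite map_inj_in_uniq // => i j /iN/andP[_ iS] /iN/andP[_ jS] /oppr_inj/(congr1 (@cen S)).
  by rewrite !cen_inZp // => -[].
Qed.

Lemma card_signed_set : #|signed_set| = (size Q + size N)%N.
Proof. by rewrite cardsE (card_uniqP uniq_elems) size_cat !size_map. Qed.

Lemma sum_signed_set (F : int -> int) :
  \sum_(f in signed_set) F (cen f) = \sum_(i <- Q) F i%:Z + \sum_(i <- N) F (- i%:Z).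
Proof.
rewrite (eq_bigl (mem elems)) => [|f]; last by rewrite inE.
rewrite -big_uniq ?uniq_elems //= big_cat !big_map; congr (_ + _).
  by apply: eq_big_seq => i /iQ/andP[_ iS]; rewrite cen_inZp.
by apply: eq_big_seq => i /iN/andP[_ iS]; rewrite cenN cen_inZp.
Qed.

End SignedSets.

Lemma sumz_seq (s : seq nat) : \sum_(i <- s) i%:Z = (sumn s)%:Z.
Proof. by elim: s => [|i s IH]; rewrite ?big_nil // big_cons IH /= PoszD. Qed.

(** [R] will be the image of [J] under [rho], so it must avoid 0 and both signs of [S]. Opposite
    pairs suffice for odd [S]; for even [S] the triple 1, 2, -3 mends the parity. *)
Lemma zero_sum_half S : (4 <= S)%N -> exists R : {set 'I_S.*2.+1},
  [/\ #|R| = S.-1, \sum_(f in R) cen f = 0 & {in R, forall f, 0 < `|cen f| < S%:Z}].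
Proof.
move=> S4; have := odd_double_half S; case: (boolP (odd S)) => oS eS.
  exists (signed_set S (iota 1 S./2) (iota 1 S./2)).
  have i1 : {in iota 1 S./2, forall i, (0 < i <= S)%N} by move=> i; rewrite mem_iota; lia.
  split.
  - by rewrite (card_signed_set i1 i1 (iota_uniq _ _) (iota_uniq _ _)) size_iota; lia.
  - by rewrite (sum_signed_set i1 i1 (iota_uniq _ _) (iota_uniq _ _) id) sumrN subrr.
  - by move=> f /(signed_setP i1 i1)[] [i]; rewrite mem_iota => ? ->; lia.
pose r := (S - 4)./2; pose Q := 1%N :: 2%N :: iota 4 r; pose N := 3%N :: iota 4 r.
have iQ : {in Q, forall i, (0 < i < S)%N}.
  by move=> i; rewrite !inE mem_iota /r; lia.
have iN : {in N, forall i, (0 < i < S)%N}.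
  by move=> i; rewrite !inE mem_iota /r; lia.
have iQ' : {in Q, forall i, (0 < i <= S)%N} by move=> i /iQ; lia.
have iN' : {in N, forall i, (0 < i <= S)%N} by move=> i /iN; lia.
have uQ : uniq Q by rewrite /= !inE !mem_iota iota_uniq.
have uN : uniq N by rewrite /= !mem_iota iota_uniq.
exists (signed_set S Q N); split.
- by rewrite (card_signed_set iQ' iN' uQ uN) /= size_iota /r; lia.
- by rewrite (sum_signed_set iQ' iN' uQ uN id) /Q /N !big_cons sumrN !sumz_seq; lia.
- by move=> f /(signed_setP iQ' iN')[] [i]; [move/iQ|move/iN] => ? ->; lia.
Qed.

(** [T] is enumerated twice, as [a], [A], rest and as [b], [B], rest; matching positions gives the
    permutation. *)
Lemma perm_with_blocks (T : finType) (a b : seq T) (A B : {set T}) :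
  uniq a -> uniq b -> size a = size b -> #|A| = #|B| ->
  {in A, forall x, x \notin a} -> {in B, forall x, x \notin b} ->
  exists rho : T -> T, [/\ injective rho, map rho a = b & rho @: A = B].
Proof.
move=> ua ub sab cAB Aa Bb.
pose ext (s : seq T) (C : {set T}) := s ++ enum C ++ enum [predC [predU s & C]].
have ext_uniq (s : seq T) (C : {set T}) : uniq s -> {in C, forall x, x \notin s} -> uniq (ext s C).
  move=> us Cs; rewrite /ext !cat_uniq us !enum_uniq /= andbT.
  rewrite has_cat negb_or -andbA; apply/and3P; split; apply/hasPn => x; rewrite /= ?mem_enum //.
  - exact: Cs.
  - by rewrite !inE negb_or => /andP[].
  - by rewrite !inE negb_or => /andP[].
have ext_mem (s : seq T) (C : {set T}) x : x \in ext s C.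
  by rewrite /ext !mem_cat !mem_enum !inE; do 2 case: (x \in _).
have ext_size (s : seq T) (C : {set T}) : uniq s -> {in C, forall x, x \notin s} ->
    size (ext s C) = #|T|.
  move=> us Cs; rewrite -(card_uniqP (ext_uniq _ _ us Cs)).
  by apply: eq_card => x; rewrite ext_mem.
pose rho x := nth x (ext b B) (index x (ext a A)).
have rhoE x y : rho x = nth y (ext b B) (index x (ext a A)).
  by apply: set_nth_default; rewrite (ext_size b B) // -(ext_size a A) // index_mem.
have rho_inj : injective rho.
  move=> x y; rewrite (rhoE y x) /rho => /eqP.
  have ix z : (index z (ext a A) < size (ext b B))%N.
    by rewrite (ext_size b B) // -(ext_size a A) // index_mem.
  by rewrite nth_uniq ?ext_uniq // => /eqP/(congr1 (nth x (ext a A))); rewrite !nth_index.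
exists rho; split=> //.
  have [x0 _|a0] := pickP (mem a); last first.
    by rewrite (size0nil (s := b)) -?sab; case: (a) a0 => // x ? /(_ x); rewrite inE mem_head.
  apply: (@eq_from_nth _ x0); first by rewrite size_map.
  rewrite size_map => i lt_i; rewrite (nth_map x0) // (rhoE _ x0).
  by rewrite index_cat mem_nth // index_uniq // nth_cat -sab lt_i.
apply/eqP; rewrite eqEcard card_imset // cAB leqnn andbT.
apply/subsetP => _ /imsetP[x xA ->].
rewrite /rho index_cat (negbTE (Aa x xA)) nth_cat sab ltnNge leq_addr /= addKn.
rewrite index_cat mem_enum xA nth_cat -cardE -cAB.
have -> : (index x (enum A) < #|A|)%N by rewrite cardE index_mem mem_enum.
by rewrite -mem_enum mem_nth // -cardE -cAB cardE index_mem mem_enum.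
Qed.

(** The wrap-around depends only on the sign of [cen f], so [sum_J] becomes linear in the sizes and
    sums of the two signed parts. *)
Lemma second_sub_first S (f : 'I_S.*2.+1) : cen f != 0 ->
  cen (- (f + f) - zhalf) - cen f =
  (if 0 < cen f then S.+1%:Z else - S%:Z) - 3 * cen f.
Proof.
have := cen_kotzig f; rewrite /cen val_addZ val_zhalf; have ltf := ltn_ord f.
move: (- (f + f) - zhalf) => g; move: (nat_of_ord f) (nat_of_ord g) ltf => a b lta.
by do 3 case: leqP => ?; case: ltnP => ?; case: ltP => ?; lia.
Qed.

Lemma odd_zero_rect K S : (0 < K)%N -> (4 <= S)%N -> zero_rect K.*2.+1 S.*2.+1.
Proof.
move=> K0 S4; have [N [Q [uN uQ iN iQ [sNQ sN bal]]]] := balanced_choice S4.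
(* [N] has fewer than [S - 1] elements, so some negative column outside [J] other than [p] remains
   for [z]. *)
have [zeta /andP[z0 zS] zN] : exists2 i, (0 < i < S)%N & i \notin N.
  have [sub|] := boolP (all (mem N) (iota 1 S.-1)).
    have := uniq_leq_size (iota_uniq 1 S.-1) (allP sub); rewrite size_iota.
    by rewrite leqNgt sN.
  by case/allPn => i; rewrite mem_iota => lei iN'; exists i => //; lia.
have iN' : {in N, forall i, (0 < i <= S)%N} by move=> i /iN; lia.
pose J := signed_set S Q N; pose z : 'I_S.*2.+1 := - inZp zeta.
have cz : cen z = - zeta%:Z by rewrite cenN cen_inZp //; lia.
pose p : 'I_S.*2.+1 := - zhalf.
have cp : cen p = - S%:Z by rewrite cenN cen_inZp.
have [R [cR sR bR]] := zero_sum_half S4.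
have cJ : #|J| = S.-1 by rewrite (card_signed_set iQ iN' uQ uN); lia.
have cne (x y : 'I_S.*2.+1) : cen x <> cen y -> x != y.
  by move=> ne; apply/eqP => E; apply: ne; rewrite E.
have zNp : z != p by apply/eqP => E; move: cz; rewrite E cp; lia.
have J0 : 0 \notin J.
  apply/negP => /(signed_setP iQ iN')[] [i]; rewrite cen0; [move/iQ|move/iN]; lia.
have Jp : p \notin J.
  apply/negP => /(signed_setP iQ iN')[] [i]; rewrite cp; [move/iQ|move/iN]; lia.
have Jz : z \notin J.
  apply/negP => /(signed_setP iQ iN')[] [i]; rewrite cz; first by move/iQ; lia.
  move=> iNi E; move: zN; have -> : zeta = i by lia.
  by rewrite iNi.
have [rho [rho_inj [r0 rp rz] rJ]] : exists rho : 'I_S.*2.+1 -> 'I_S.*2.+1,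
    [/\ injective rho, map rho [:: 0; p; z] = [:: p; zhalf; 0] & rho @: J = R].
  have ch : cen (zhalf : 'I_S.*2.+1) = S%:Z by rewrite cen_inZp.
  apply: perm_with_blocks; rewrite ?cJ ?cR //=.
  - rewrite !inE !negb_or -!andbA ?andbT; apply/and3P; split; apply: cne;
      rewrite ?cp ?cz ?cen0; clear -S4 z0 zS; lia.
  - rewrite !inE !negb_or -!andbA ?andbT; apply/and3P; split; apply: cne;
      rewrite ?cp ?ch ?cen0; clear -S4; lia.
  - by move=> f fJ; rewrite !inE !negb_or (memPn J0) // (memPn Jp) // (memPn Jz).
  - move=> f /bR bf; rewrite !inE !negb_or -?andbA; apply/and3P; split; apply: cne;
      rewrite ?cp ?ch ?cen0; clear -S4 bf; lia.
apply: (@rect_zero_rect K S K0 _ J z rho) => //.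
- by lia.
- by have := cz; rewrite /cen; case: leqP => //; lia.
- pose w (c : int) := (if 0 < c then S.+1%:Z else - S%:Z) - 3 * c.
  rewrite (eq_bigr (fun f => w (cen f))) => [|f fJ]; last first.
    apply: second_sub_first; apply: contraNneq J0 => E.
    by rewrite -(cen_inj (etrans E (esym (cen0 S)))).
  rewrite (sum_signed_set iQ iN' uQ uN w) /w.
  rewrite (eq_big_seq (fun i : nat => S.+1%:Z - 3 * i%:Z)) => [|i /iQ i_in]; last first.
    by rewrite (_ : 0 < i%:Z) //; clear -i_in; lia.
  rewrite [X in _ + X](eq_big_seq (fun i : nat => 3 * i%:Z - S%:Z)) => [|i /iN i_in]; last first.
    by rewrite (_ : (0 < - i%:Z) = false); clear -i_in; lia.
  rewrite !sumrB -!mulr_sumr !sumz_seq !big_const_seq !count_predT !iter_addr_0.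
  have cst (x : int) n : x *+ n = x * n%:Z by rewrite -mulr_natr natz.
  move: bal; rewrite !cst; move: (sumn N) (sumn Q) (size N) (size Q); clear => a b c d.
  by nia.
- by rewrite r0 cp.
- by rewrite rp cen_inZp.
- by rewrite rz cen0.
- by rewrite -[RHS]sR -rJ big_imset //= => f g _ _; apply: rho_inj.
Qed.

(** * Small coprime rectangles by explicit tables *)

Lemma zero_rect_of_table k s (tab : seq (seq int)) :
  (0 < s)%N ->
  let f i j := nth 0 (nth [::] tab i) j in
  [&& uniq (mkseq (fun t => f (t %/ s)%N (t %% s)%N) (k * s)),
      all (fun i => all (fun j => `|f i j| <= ((k * s)%N./2)%:Z) (iota 0 s)) (iota 0 k),
      all (fun i => foldr +%R 0 [seq f i j | j <- iota 0 s] == 0) (iota 0 k) &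
      all (fun j => foldr +%R 0 [seq f i j | i <- iota 0 k] == 0) (iota 0 s)] ->
  zero_rect k s.
Proof.
move=> s0 f /and4P[/mkseq_uniqP inj /allP bnd /allP rows /allP cols].
have sumE n (F : nat -> int) : \sum_(t < n) F t = foldr +%R 0 [seq F t | t <- iota 0 n].
  by rewrite -(big_mkord xpredT) /index_iota subn0 foldrE big_map.
have inI n (t : 'I_n) : (t : nat) \in iota 0 n by rewrite mem_iota /=.
exists (fun y : 'I_k * 'I_s => f y.1 y.2); split=> /=.
- move=> [i j] [i' j'] /= E.
  have lt (a : 'I_k) (b : 'I_s) : (a * s + b < k * s)%N.
    by have := ltn_ord a; have := ltn_ord b; nia.
  have := inj (i * s + j)%N (i' * s + j')%N (lt _ _) (lt _ _).
  rewrite !divnMDl // !modnMDl !divn_small // !modn_small // !addn0 => /(_ E) e.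
  have := congr1 (divn^~ s) e; have := congr1 (modn^~ s) e.
  rewrite /= !divnMDl // !modnMDl !divn_small // !modn_small // !addn0 => ej ei.
  by congr (_, _); apply: val_inj.
- by move=> [i j]; apply: (allP (bnd i (inI _ _))).
- by move=> i; rewrite (sumE s (f i)); apply/eqP/rows.
- by move=> j; rewrite (sumE k (f^~ j)); apply/eqP/cols.
Qed.

Lemma zero_rect_3_5 : zero_rect 3 5.
Proof.
by apply: (@zero_rect_of_table 3 5
  [:: [:: 0; -3; 3; -6; 6]; [:: -7; 5; 1; 2; -1]; [:: 7; -2; -4; 4; -5]]).
Qed.

Lemma zero_rect_3_7 : zero_rect 3 7.
Proof.
by apply: (@zero_rect_of_table 3 7
  [:: [:: -2; -9; 6; 9; 7; -3; -8]; [:: -6; -1; 4; -4; 0; 2; 5];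
      [:: 8; 10; -10; -5; -7; 1; 3]]).
Qed.

Lemma zero_rect_5_7 : zero_rect 5 7.
Proof.
by apply: (@zero_rect_of_table 5 7
  [:: [:: -3; -16; 9; 8; 3; 13; -14]; [:: -4; 14; -17; 16; 5; -5; -9];
      [:: 17; 0; -6; -11; 6; -7; 1]; [:: -2; -10; 10; -15; -1; 11; 7];
      [:: -8; 12; 4; 2; -13; -12; 15]]).
Qed.

(** * The odd case *)

Lemma zero_rect_transpose k s : zero_rect k s -> zero_rect s k.
Proof.
case=> L [L_inj L_bound rows cols]; exists (fun y => L (y.2, y.1)); split=> //.
- by move=> [i j] [i' j'] /L_inj[-> ->].
- by move=> y; rewrite mulnC.
Qed.

(** The general construction, up to transposition, needs one side of length at least 9. Among 3, 5
    and 7 coprimality leaves only the tabulated pairs. *)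
Lemma coprime_zero_rect k s : odd k -> odd s -> (2 <= k)%N -> (2 <= s)%N ->
  coprime k s -> zero_rect k s.
Proof.
move=> ok os k2 s2 cop.
have ek := odd_double_half k; have es := odd_double_half s; rewrite ok os /= in ek es.
have [S4|] := leqP 4 s./2; first by rewrite -ek -es; apply: odd_zero_rect; lia.
have [K4|] := leqP 4 k./2.
  by move=> _; apply: zero_rect_transpose; rewrite -ek -es; apply: odd_zero_rect; lia.
move: k2 s2 cop; rewrite -ek -es; clear.
move: (k./2) (s./2) => [|[|[|[|//]]]] [|[|[|[|//]]]] // _ _ _ _ _.
- exact: zero_rect_3_5.
- exact: zero_rect_3_7.
- exact/zero_rect_transpose/zero_rect_3_5.
- exact: zero_rect_5_7.
- exact/zero_rect_transpose/zero_rect_3_7.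
- exact/zero_rect_transpose/zero_rect_5_7.
Qed.

(* Here [e] is the gcd of [s] and [k]: the array is viewed as a [d * d] grid of
   [k0 * s0] blocks, to be filled on [e] cyclic diagonals. *)
Lemma block_decomposition m n s k : (0 < s)%N -> (m * s = n * k)%N ->
  exists e s0 k0 d,
    [/\ s = (e * s0)%N, k = (e * k0)%N, coprime s0 k0, m = (k0 * d)%N & n = (s0 * d)%N].
Proof.
move=> s_gt0 eqT; set e := gcdn s k; have e0 : (0 < e)%N by rewrite gcdn_gt0 s_gt0.
have /dvdnP[s0 es] := dvdn_gcdl s k; have /dvdnP[k0 ek] := dvdn_gcdr s k.
rewrite -/e in es ek; have s00 : (0 < s0)%N by move: s_gt0; rewrite es; case: (s0).
have cop : coprime s0 k0.
  by rewrite /coprime -(eqn_pmul2r e0) mul1n muln_gcdl -es -ek.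
have eqm : (m * s0 = n * k0)%N.
  by apply/eqP; rewrite -(eqn_pmul2r e0) -!mulnA -es -ek eqT.
have /dvdnP[d en] : (s0 %| n)%N.
  by rewrite -(Gauss_dvdl _ cop) -eqm dvdn_mull.
exists e, s0, k0, d; split=> //; rewrite 1?mulnC //.
by apply/eqP; rewrite -(eqn_pmul2r s00) eqm en; apply/eqP; lia.
Qed.

Lemma MRS_odd m n s k c : (2 <= s <= n)%N -> (2 <= k <= m)%N -> (m * s = n * k)%N ->
  odd (n * k * c)%N -> MRS_exists m n s k c.
Proof.
move=> /andP[s2 sn] /andP[k2 km] eqT; rewrite !oddM => /andP[/andP[on ok] oc].
have /andP[om os] : odd m && odd s by rewrite -oddM eqT oddM on ok.
have [|e [s0 [k0 [d [es ek cop em en]]]]] := block_decomposition _ eqT; first by lia.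
have /andP[oe os0] : odd e && odd s0 by rewrite -oddM -es.
have /andP[ok0 od] : odd k0 && odd d by rewrite -oddM -em.
have ed : (e <= d)%N.
  by move: sn; rewrite es en mulnC leq_pmul2l //; case: (s0) os0.
have [e3|] := leqP 3 e.
  have eqd : d = d./2.*2.+1 by rewrite -[LHS]odd_double_half od.
  have [|H [L [tau base]]] := @diag_odd_base d./2 e oe; first by rewrite e3 -eqd.
  (* Each cell of the square array on [e] diagonals becomes a full [k0 * s0] block. *)
  have := MRS_of_odd_base (G := 'I_c) (D := 'I_1) (U := 'I_k0) (V := 'I_s0) base.
  rewrite !cardsT !card_prod !card_ord !mul1n -eqd !oddM oc ok0 os0 => /(_ isT).
  by rewrite es ek em en [(k0 * d)%N]mulnC [(s0 * d)%N]mulnC.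
move=> e_lt3; have e1 : e = 1%N by case: e e_lt3 oe {es ek ed} => [|[|[|]]].
move: es ek; rewrite e1 !mul1n => es ek; rewrite -es -ek in cop em en *.
have s3 : (3 <= s)%N by case: (s) s2 os => [|[|[|]]].
have k3 : (3 <= k)%N by case: (k) k2 ok => [|[|[|]]].
rewrite coprime_sym in cop.
have [H [L [tau base]]] := rect_odd_base ok os k3 s3 (coprime_zero_rect ok os k2 s2 cop).
(* Now [e = 1]: each array consists of [d] full rectangles along its diagonal. *)
have := MRS_of_odd_base (G := 'I_c) (D := 'I_d) (U := 'I_1) (V := 'I_1) base.
rewrite !cardsT !card_prod !card_ord !muln1 !oddM oc od => /(_ isT).
by rewrite em en [(k * d)%N]mulnC [(s * d)%N]mulnC.
Qed.

(** * Even case: signed partitions *)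

(** With an even number of cells the centred labels are half-integers; doubled, they are the odd
    integers. *)
Definition signed_odd (b : bool) (l : nat) : int := (-1) ^+ b * (2 * l%:Z + 1).

(** By counting, [l] is a bijection onto the numbers below [N * w]; [F] records the bundle sums,
    which the arrays will have to match along cyclic groups of rows. *)
Definition signed_partition (N w : nat) (F : nat -> int) :=
  exists (b : nat -> nat -> bool) (l : nat -> nat -> nat),
  [/\ forall i j, (i < N)%N -> (j < w)%N -> (l i j < N * w)%N,
      forall i j i' j', (i < N)%N -> (j < w)%N -> (i' < N)%N -> (j' < w)%N ->
        l i j = l i' j' -> i = i' /\ j = j' &
      forall i, (i < N)%N -> \sum_(j < w) signed_odd (b i j) (l i j) = F i].

Lemma signed_partition0 N : signed_partition N 0 (fun=> 0).
Proof.
by exists (fun _ _ => false), (fun _ _ => 0%N); split=> // i _; rewrite big_ord0.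
Qed.

(** Labels from [N * w] on are dealt out in runs of [u] consecutive ones; the sign pattern must have
    the same sum wherever the run starts. *)
Lemma signed_partition_add N w u F (beta : nat -> bool) G :
  (forall o, \sum_(j < u) signed_odd (beta j) (o + j) = G) ->
  signed_partition N w F -> signed_partition N (w + u) (fun i => F i + G).
Proof.
move=> sumG [b [l [l_lt l_inj sumF]]].
exists (fun i j => if (j < w)%N then b i j else beta (j - w)%N).
exists (fun i j => if (j < w)%N then l i j else N * w + i * u + (j - w))%N; split.
- move=> i j iN jwu; case: (ltnP j w) => jw; first by have := l_lt i j iN jw; nia.
  by nia.
- move=> i j i' j' iN jwu iN' jwu'; case: (ltnP j w) => jw; case: (ltnP j' w) => jw' E.
  + exact: l_inj.
  + by have := l_lt i j iN jw; nia.
  + by have := l_lt i' j' iN' jw'; nia.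
  + have E' : (i * u + (j - w) = i' * u + (j' - w))%N by lia.
    have ii : i = i' by nia.
    by subst i'; split=> //; lia.
- move=> i iN; rewrite big_split_ord /=; congr (_ + _).
    by rewrite -(sumF i iN); apply: eq_bigr => j _; rewrite ltn_ord.
  rewrite -(sumG (N * w + i * u)%N); apply: eq_bigr => j _.
  by rewrite ltnNge leq_addr /= addKn.
Qed.

Lemma signed_partition_add4 N w F r :
  signed_partition N w F -> signed_partition N (w + 4 * r) F.
Proof.
move=> P; elim: r => [|r [b [l [h1 h2 h3]]]]; first by rewrite muln0 addn0.
have beta o : \sum_(j < 4) signed_odd ((0 < j) && (j < 3))%N (o + j) = 0.
  by rewrite !big_ord_recr big_ord0 /signed_odd /=; lia.
have -> : (w + 4 * r.+1 = w + 4 * r + 4)%N by lia.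
have [|b' [l' [h1' h2' h3']]] := @signed_partition_add N (w + 4 * r) 4 F
  (fun j => (0 < j) && (j < 3))%N _ beta.
  by exists b, l.
by exists b', l'; split=> // i /h3' ->; rewrite addr0.
Qed.

Lemma signed_partition_add2 N w F :
  signed_partition N w F -> signed_partition N (w + 2) (fun i => F i + 2).
Proof.
apply: (@signed_partition_add _ _ _ _ (fun j => j == 0%N)) => o.
by rewrite !big_ord_recr big_ord0 /signed_odd /=; lia.
Qed.

(* Triples [x + y - z] with [z - x - y] constant, one Kotzig array for each
   group of [d] consecutive rows; this is where [d] has to be odd. *)
Lemma signed_partition3 g h :
  exists F, signed_partition (g * h.*2.+1) 3 (fun i => F (i %/ h.*2.+1)%N).
Proof.
set d := h.*2.+1; pose p i : 'I_d := inZp i.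
pose c (x : 'I_d) := absz (cen x + h%:Z).
have cE x : (c x)%:Z = cen x + h%:Z by rewrite /c; have := cen_bound x; lia.
have c_lt x : (c x < d)%N by have := cE x; have := cen_bound x; rewrite /d; lia.
have c_inj x y : c x = c y -> x = y.
  by move=> E; apply: cen_inj; have := cE x; have := cE y; rewrite E; lia.
(* The last entry is the opposite of the third Kotzig row and is taken with sign minus, so the
   signed sum depends only on the group [i %/ d]. *)
pose t j (x : 'I_d) : 'I_d := match j with 0 => x | 1 => x + zhalf | _ => x + x + zhalf end.
have t_inj j : injective (t j).
  case: j => [|[|j]] x y //=; first exact: addIr.
  by move=> /addIr/addZZ_inj.
exists (fun a => 6 * d%:Z * a%:Z + 2 * h%:Z - 2 * d%:Z + 1).
exists (fun _ j => j == 2%N).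
exists (fun i j => 3 * d * (i %/ d) + d * j + c (t j (p i)))%N; split.
- move=> i j iN j3; have := c_lt (t j (p i)).
  have : (i %/ d < g)%N by rewrite ltn_divLR.
  by nia.
- move=> i j i' j' iN j3 iN' j3' E.
  have c1 := c_lt (t j (p i)); have c2 := c_lt (t j' (p i')).
  have e1 : (i %/ d = i' %/ d)%N by nia.
  have e2 : j = j' by nia.
  subst j'; split=> //; rewrite (divn_eq i d) (divn_eq i' d) e1; congr (_ + _)%N.
  by move: E; rewrite e1 => /addnI/c_inj/t_inj/(congr1 val).
- move=> i iN; rewrite !big_ord_recr big_ord0 /signed_odd /= add0r.
  have := cen_kotzig (p i); rewrite -opprD cenN.
  have := cE (p i); have := cE (p i + zhalf); have := cE (p i + p i + zhalf).
  rewrite expr0 expr1 mulN1r !mul1r; move: (c _) (c _) (c _) (i %/ d)%N => a1 a2 a3 q.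
  by move: (cen _) (cen _) (cen _); clear; nia.
Qed.

(** Induction by two bundles: [T1] and [T2] split twelve consecutive labels, and in each the first
    three have the same sum as the last three, at any offset. Odd [N] starts from
    [1 + 3 + 5 - 7 + 9 - 11 = 0]. *)
Lemma signed_partition6 N : signed_partition N 6 (fun=> 0).
Proof.
pose T1 := [:: 0; 2; 6; 1; 3; 4]%N; pose T2 := [:: 5; 9; 11; 7; 8; 10]%N.
suff : signed_partition N 6 (fun=> 0) /\ signed_partition N.+1 6 (fun=> 0) by case.
elim: N => [|N [P P1]].
  split; first by exists (fun _ _ => false), (fun _ _ => 0%N).
  exists (fun _ j => (j == 3) || (j == 5))%N, (fun _ j => j); split=> //.
    by move=> [|i] j [|i'] j'.
  by move=> [|i] // _; rewrite !big_ord_recr big_ord0 /signed_odd.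
split=> //; case: P => b [l [l_lt l_inj sumF]].
exists (fun i j => if (i < N)%N then b i j else (3 <= j)%N).
exists (fun i j => if (i < N)%N then l i j else 6 * N + nth 0 (if i == N then T1 else T2) j)%N.
have T_lt i j : (j < 6)%N -> (nth 0 (if i == N then T1 else T2) j < 12)%N.
  by case: eqP => _; case: j => [|[|[|[|[|[|]]]]]].
split.
- move=> i j iN j6; case: (ltnP i N) => [iN0|_]; first by have := l_lt i j iN0 j6; lia.
  by have := T_lt i j j6; lia.
- move=> i j i' j' iN j6 iN' j6'; case: (ltnP i N) => [iN0|Ni]; case: (ltnP i' N) => [iN0'|Ni'].
  + exact: l_inj.
  + by have := l_lt i j iN0 j6; lia.
  + by have := l_lt i' j' iN0' j6'; lia.
  + move/addnI => E; have : (i == i') && (j == j'); last by case/andP=> /eqP-> /eqP->.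
    have ei : i = N \/ i = N.+1 by lia.
    have ei' : i' = N \/ i' = N.+1 by lia.
    have nN : (N.+1 == N) = false by lia.
    move: E; case: ei => ->; case: ei' => ->; rewrite ?eqxx ?nN;
      move: j j' j6 j6' => [|[|[|[|[|[|]]]]]] // [|[|[|[|[|[|]]]]]] //.
- move=> i iN; case: (ltnP i N) => [iN0|Ni]; first exact: sumF.
  by rewrite !big_ord_recr big_ord0 /signed_odd /=; case: eqP => _ /=; lia.
Qed.

(** * Even case: bundles *)

(* Each signed label [z] of bundle [be] occupies two cells of a common column:
   [z] goes to the row [ro be false] and [- z] to the row [ro be true]. *)
Lemma MRS_of_bundles (G R Q B W : finType) (ar : B -> G) (ro : B -> bool -> R)
    (co : B -> W -> Q) (idx : B -> nat) (F : nat -> int) (a k : nat) :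
  injective (fun t : B * W * bool => (ar t.1.1, ro t.1.1 t.2, co t.1.1 t.1.2)) ->
  injective idx -> (forall be, idx be < #|B|)%N ->
  signed_partition #|B| #|W| F ->
  (forall g r, #|[pred y : B * bool | (ar y.1 == g) && (ro y.1 y.2 == r)]| = a) ->
  (forall g q, #|[pred y : B * W | (ar y.1 == g) && (co y.1 y.2 == q)]| = k) ->
  (forall g r, \sum_(y : B * bool | (ar y.1 == g) && (ro y.1 y.2 == r))
                 (-1) ^+ y.2 * F (idx y.1) = 0) ->
  MRS_exists #|R| #|Q| (a * #|W|) (k * 2) #|G|.
Proof.
move=> pos_inj idx_inj idx_lt [b [l [l_lt l_inj sumF]]] rowc colc row0.
pose X := (B * W * bool)%type; pose T := (#|B| * #|W|)%N.
pose lv (t : X) := l (idx t.1.1) (enum_rank t.1.2).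
pose bv (t : X) := t.2 (+) b (idx t.1.1) (enum_rank t.1.2).
(* Positive labels count upwards from the middle of the range and negative ones downwards, so that
   [2 * lab + 1] is the signed odd number shifted by [2 * T]. *)
pose lab (t : X) := (if bv t then T - (lv t).+1 else T + lv t)%N.
have lv_lt t : (lv t < T)%N by apply: l_lt.
have cardX : #|{: X}| = (2 * T)%N by rewrite !card_prod card_bool mulnC.
pose ze (t : X) := signed_odd (bv t) (lv t).
have labE t : 2 * (lab t)%:Z + 1 = ze t + 2 * T%:Z.
  by rewrite /lab /ze /signed_odd; have := lv_lt t; case: (bv t); rewrite ?expr0 ?expr1; lia.
have zeE t : ze t = (-1) ^+ t.2 * signed_odd (b (idx t.1.1) (enum_rank t.1.2)) (lv t).
  by rewrite /ze /signed_odd /bv mulrA; case: t.2; case: (b _ _);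
    rewrite /= ?expr0 ?expr1 ?mulN1r ?mul1r ?opprK.
have lab_sum (P : pred X) n : #|P| = n -> \sum_(t | P t) ze t = 0 ->
    (\sum_(t | P t) (lab t).+1 = (n * (2 * T).+1)./2)%N.
  move=> cP sP; suff E : ((\sum_(t | P t) (lab t).+1) * 2 = n * (2 * T).+1)%N.
    by rewrite -E muln2 doubleK.
  apply/eqP; rewrite -(eqr_nat int) !natrM natr_sum mulr_suml.
  rewrite (eq_bigr (fun t => ze t + (2 * T).+1%:R)) => [|t _]; last by have := labE t; lia.
  by rewrite big_split /= sP add0r sumr_const cP mulr_natl.
have rowE (V : nmodType) (f : X -> V) g r :
    \sum_(t : X | (ar t.1.1 == g) && (ro t.1.1 t.2 == r)) f t =
    \sum_(y : B * bool | (ar y.1 == g) && (ro y.1 y.2 == r)) \sum_w f (y.1, w, y.2).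
  rewrite pair_big_dep /= (reindex_onto (fun u : B * bool * W => (u.1.1, u.2, u.1.2))
    (fun t : X => (t.1.1, t.2, t.1.2))) /= => [|[[be w] e] _] //.
  by apply: eq_bigl => -[[be e] w]; rewrite /= eqxx !andbT.
have colE (V : nmodType) (f : X -> V) g q :
    \sum_(t : X | (ar t.1.1 == g) && (co t.1.1 t.1.2 == q)) f t =
    \sum_(y : B * W | (ar y.1 == g) && (co y.1 y.2 == q)) \sum_e f (y, e).
  rewrite pair_big_dep /=; apply: eq_big => [[[be w] e]|[[be w] e] _] //=.
  by rewrite andbT.
have count_row g r : #|[pred t : X | (ar t.1.1 == g) && (ro t.1.1 t.2 == r)]| = (a * #|W|)%N.
  rewrite -sum1_card (rowE _ (fun=> 1%N)) -(rowc g r) -sum1_card big_distrl /=.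
  by apply: eq_bigr => y _; rewrite sum1_card mul1n.
have count_col g q : #|[pred t : X | (ar t.1.1 == g) && (co t.1.1 t.1.2 == q)]| = (k * 2)%N.
  rewrite -sum1_card (colE _ (fun=> 1%N)) -(colc g q) -sum1_card big_distrl /=.
  by apply: eq_bigr => y _; rewrite sum1_card mul1n card_bool.
apply: (MRS_of_labelling (ar := fun t : X => ar t.1.1) (ro := fun t => ro t.1.1 t.2)
  (co := fun t => co t.1.1 t.1.2) (lab := lab) (x := (a * #|W| * (2 * T).+1)./2%N)
  (y := (k * 2 * (2 * T).+1)./2%N)) => //.
- move=> t u E; have Ez : ze t = ze u by have := labE t; have := labE u; rewrite E; lia.
  have [bb ll] : bv t = bv u /\ lv t = lv u.
    by move: Ez; rewrite /ze /signed_odd; case: (bv t); case: (bv u);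
      rewrite ?expr0 ?expr1; lia.
  have [ii jj] := l_inj _ _ _ _ (idx_lt _) (ltn_ord _) (idx_lt _) (ltn_ord _) ll.
  move: bb; rewrite /bv ii jj => /addIb; move: ii jj.
  case: t u {E Ez ll} => [[be w] e] [[be' w'] e'] /= /idx_inj-> /val_inj/enum_rank_inj-> ->.
  by [].
- by move=> t; rewrite cardX /lab; have := lv_lt t; case: ifP => _; lia.
- move=> g r; apply: lab_sum; first exact: count_row.
  rewrite rowE -[RHS](row0 g r); apply: eq_bigr => -[be e] _ /=.
  rewrite -(sumF _ (idx_lt be)) mulr_sumr (reindex (@enum_val W xpredT)) /=; last first.
    by exists enum_rank => ? _; rewrite ?enum_rankK ?enum_valK.
  by apply: eq_bigr => j _; rewrite zeE /= /lv /= enum_valK.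
- move=> g q; apply: lab_sum; first exact: count_col.
  rewrite colE; apply: big1 => y _; rewrite big_bool !zeE /lv /=.
  by rewrite expr0 expr1 mulN1r mul1r addNr.
Qed.

(** * Even case: placing the bundles *)

Lemma zone_mul_inj d i j : (i <= d)%N -> (j <= d)%N ->
  zone *+ i = zone *+ j :> 'I_d.+1 -> i = j.
Proof.
by move=> id jd /(congr1 (@nat_of_ord _)); rewrite !val_mul_zone !modn_small.
Qed.

(** Bundle [p] fills rows [p] and [p + 1], with opposite signs, in the columns [p - 2t]. Row minus
    column is [2t + b], so the cells are distinct when [2 * e <= d.+1]. A row meets two bundles of
    the same cyclic group, whose equal sums cancel. *)
Lemma MRS_even_cyclic c k0 s0 e d F : (2 * e <= d.+1)%N ->
  signed_partition (c * k0 * d.+1) (e * s0) (fun i => F (i %/ d.+1)%N) ->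
  MRS_exists (d.+1 * k0) (d.+1 * s0) (2 * (e * s0)) (k0 * e * 2) c.
Proof.
move=> ed P; pose B := ('I_c * 'I_k0 * 'I_d.+1)%type; pose W := ('I_e * 'I_s0)%type.
pose ar (be : B) := be.1.1.
pose ro (be : B) (b : bool) := (be.2 + zone *+ b, be.1.2).
pose co (be : B) (w : W) := (be.2 - zone *+ (2 * w.1), w.2).
pose idx (be : B) := (enum_rank be.1 * d.+1 + be.2)%N.
have idx_div be : (idx be %/ d.+1 = enum_rank be.1)%N by rewrite divnMDl // divn_small ?addn0.
have rowE (V : nmodType) (f : B * bool -> V) g q u :
    \sum_(y : B * bool | (ar y.1 == g) && (ro y.1 y.2 == (q, u))) f y =
    \sum_(b : bool) f ((g, u, q - zone *+ b), b).
  rewrite (reindex_onto (fun b : bool => ((g, u, q - zone *+ b), b)) snd) /=.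
    by apply: eq_bigl => b; rewrite /ar /ro /= subrK !eqxx.
  case=> [[[g' u'] p] b]; rewrite /ar /ro /= xpair_eqE => /andP[/eqP-> /andP[/eqP<- /eqP->]].
  by rewrite addrK.
have colE (f : B * W -> nat) g q v :
    (\sum_(y : B * W | (ar y.1 == g) && (co y.1 y.2 == (q, v))) f y =
    \sum_(x : 'I_k0 * 'I_e) f ((g, x.1, (q + zone *+ (2 * x.2))%R), (x.2, v)))%N.
  rewrite (reindex_onto (fun x : 'I_k0 * 'I_e => ((g, x.1, q + zone *+ (2 * x.2)), (x.2, v)))
    (fun y : B * W => (y.1.1.2, y.2.1))) /=.
    by apply: eq_bigl => -[u t]; rewrite /ar /co /= addrK !eqxx.
  case=> [[[g' u] p] [t v']]; rewrite /ar /co /= xpair_eqE => /andP[/eqP-> /andP[/eqP<- /eqP->]].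
  by rewrite subrK.
have := @MRS_of_bundles _ _ _ B W ar ro co idx (fun i => F (i %/ d.+1)%N) 2 (k0 * e)%N.
rewrite !card_prod !card_ord; apply=> //.
- move=> [[[[g u] p] [t v]] b] [[[[g' u'] p'] [t' v']] b'] E0.
  have Er : p + zone *+ b = p' + zone *+ b' := congr1 (fun x => x.1.2.1) E0.
  have Ec : p - zone *+ (2 * t) = p' - zone *+ (2 * t') := congr1 (fun x => x.2.1) E0.
  have -> : g = g' := congr1 (fun x => x.1.1) E0.
  have -> : u = u' := congr1 (fun x => x.1.2.2) E0.
  have -> : v = v' := congr1 (fun x => x.2.2) E0.
  have sub (x y w : 'I_d.+1) : (x + y) - (x - w) = w + y.
    by rewrite opprB addrC addrA subrK.
  have E : zone *+ (2 * t + b) = zone *+ (2 * t' + b') :> 'I_d.+1.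
    by rewrite (mulrnDr _ (2 * t)) (mulrnDr _ (2 * t')) -(sub p) Er Ec sub.
  have lt_b (a : bool) : (a <= 1)%N by case: a.
  have E2 : (2 * t + b = 2 * t' + b')%N.
    apply: zone_mul_inj E.
      by have := ltn_ord t; have := lt_b b; move: ed; clear; lia.
    by have := ltn_ord t'; have := lt_b b'; move: ed; clear; lia.
  have eb : b = b' by move: E2; clear; case: b; case: b'; lia.
  have et : t = t' by apply: val_inj; move: E2; rewrite /= eb; clear; lia.
  by move: Er; rewrite eb et => /addIr ->.
- move=> [x p] [x' p'] E; have := idx_div (x, p); rewrite E idx_div => /val_inj/enum_rank_inj /= ex.
  by move: E; rewrite /idx ex => /addnI/val_inj /= ->.
- move=> [x p]; rewrite /idx /=; have := ltn_ord (enum_rank x); have := ltn_ord p.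
  have cx : #|{: 'I_c * 'I_k0}| = (c * k0)%N by rewrite card_prod !card_ord.
  by move: (nat_of_ord p) (nat_of_ord (enum_rank x)) cx => i j ->; clear; nia.
- by move=> g [q u]; rewrite -sum1_card (rowE _ (fun=> 1%N)) sum1_card card_bool.
- by move=> g [q v]; rewrite -sum1_card (colE (fun=> 1%N)) sum1_card card_prod !card_ord.
- move=> g [q u]; rewrite rowE big_bool !idx_div /=.
  by rewrite expr0 expr1 mulN1r mul1r addNr.
Qed.

(** The variant for a grid of even side: rows come in pairs, and one bundle of double size fills a
    pair. As a row meets a single bundle, every bundle sum has to vanish. *)
Lemma MRS_even_paired c k0 s0 e d : (e <= d.+1)%N ->
  signed_partition (c * k0 * d.+1) (e * 2 * s0) (fun=> 0) ->
  MRS_exists (d.+1 * 2 * k0) (d.+1 * 2 * s0) (e * 2 * s0) (k0 * e * 2) c.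
Proof.
move=> ed P; pose B := ('I_c * 'I_k0 * 'I_d.+1)%type; pose W := ('I_e * bool * 'I_s0)%type.
pose ar (be : B) := be.1.1.
pose ro (be : B) (b : bool) := (be.2, b, be.1.2).
pose co (be : B) (w : W) := (be.2 - zone *+ w.1.1, w.1.2, w.2).
have rowE (V : nmodType) (f : B * bool -> V) g q b u :
    \sum_(y : B * bool | (ar y.1 == g) && (ro y.1 y.2 == (q, b, u))) f y = f ((g, u, q), b).
  rewrite (big_pred1 ((g, u, q), b)) // => -[[[g' u'] q'] b']; rewrite /ar /ro /= !xpair_eqE.
  by rewrite -!andbA; case: (g' == g) => //=; case: (q' == q); case: (b' == b);
    rewrite ?andbT ?andbF.
have colE (f : B * W -> nat) g q h v :
    (\sum_(y : B * W | (ar y.1 == g) && (co y.1 y.2 == (q, h, v))) f y =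
    \sum_(x : 'I_k0 * 'I_e) f ((g, x.1, (q + zone *+ x.2)%R), (x.2, h, v)))%N.
  rewrite (reindex_onto (fun x : 'I_k0 * 'I_e => ((g, x.1, q + zone *+ x.2), (x.2, h, v)))
    (fun y : B * W => (y.1.1.2, y.2.1.1))) /=.
    by apply: eq_bigl => -[u t]; rewrite /ar /co /= addrK !eqxx.
  case=> [[[g' u] p] [[t h'] v']]; rewrite /ar /co /= !xpair_eqE.
  by move=> /andP[/eqP-> /andP[/andP[/eqP<- /eqP->] /eqP->]]; rewrite subrK.
pose idx (be : B) : nat := enum_rank be.
have cB : #|{: B}| = (c * k0 * d.+1)%N by rewrite !card_prod !card_ord.
have idx_lt be : (idx be < c * k0 * d.+1)%N by rewrite -cB ltn_ord.
have := @MRS_of_bundles _ _ _ B W ar ro co idx (fun=> 0) 1 (k0 * e)%N.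
rewrite !card_prod card_bool !card_ord mul1n; apply=> //.
- move=> [[[[g u] p] [[t h] v]] b] [[[[g' u'] p'] [[t' h'] v']] b'] E0.
  have Ec : p - zone *+ t = p' - zone *+ t' := congr1 (fun x => x.2.1.1) E0.
  have ep : p = p' := congr1 (fun x => x.1.2.1.1) E0.
  have -> : g = g' := congr1 (fun x => x.1.1) E0.
  have -> : u = u' := congr1 (fun x => x.1.2.2) E0.
  have -> : b = b' := congr1 (fun x => x.1.2.1.2) E0.
  have -> : v = v' := congr1 (fun x => x.2.2) E0.
  have -> : h = h' := congr1 (fun x => x.2.1.2) E0.
  move: Ec; rewrite ep => /addrI/oppr_inj E.
  have -> // : t = t'; apply: val_inj; apply: zone_mul_inj E;
    by rewrite -ltnS (leq_trans _ ed).
- by move=> x y /val_inj/enum_rank_inj.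
- by move=> g [[q b] u]; rewrite -sum1_card (rowE _ (fun=> 1%N)).
- by move=> g [[q h] v]; rewrite -sum1_card (colE (fun=> 1%N)) sum1_card card_prod !card_ord.
- by move=> g [[q b] u]; rewrite rowE mulr0.
Qed.

Lemma MRS_even_wide m n s k c : (4 <= s <= n)%N -> (2 <= k <= m)%N -> (m * s = n * k)%N ->
  ~~ odd s -> ~~ odd k -> MRS_exists m n s k c.
Proof.
move=> /andP[s4 sn] /andP[k2 km] eqT os ok.
have es : s = (s./2 * 2)%N by rewrite muln2 even_halfK.
have ek : k = (k./2 * 2)%N by rewrite muln2 even_halfK.
have eqT2 : (m * s./2 = n * k./2)%N.
  by apply/eqP; rewrite -(eqn_pmul2r (isT : 0 < 2)%N) -!mulnA -es -ek eqT.
have [|e [s0 [k0 [d [es0 ek0 _ em en]]]]] := block_decomposition _ eqT2; first by lia.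
have ed : (2 * e <= d)%N.
  have : (s0 * (2 * e) <= s0 * d)%N by move: sn; rewrite es es0 en; lia.
  by rewrite leq_pmul2l //; case: (s0) es0 es s4 => //; rewrite muln0 => -> ->.
set w := (e * s0)%N; have w2 : (2 <= w)%N by rewrite /w -es0; lia.
have e0 : (0 < e)%N by case: (e) es0 es s4 => //; rewrite mul0n => -> ->.
case: d em en ed => [|d] em en ed; first by lia.
have cyclic F : signed_partition (c * k0 * d.+1) w (fun i => F (i %/ d.+1)%N) ->
    MRS_exists m n s k c.
  move=> /(MRS_even_cyclic ed); rewrite es ek es0 ek0 em en.
  by rewrite [(d.+1 * k0)%N]mulnC [(d.+1 * s0)%N]mulnC [(k0 * e)%N]mulnC [(2 * _)%N]mulnC.
(* Quadruples reduce [w] modulo 4. For even [w] at most one consecutive pair is left over. *)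
have [ow|ew] := boolP (odd w); last first.
  have := odd_double_half w./2; case: (odd w./2) => [|] /= ew2.
    apply: (cyclic (fun=> 0 + 2)); have -> : (w = 2 + 4 * w./2./2)%N by lia.
    exact/signed_partition_add4/(@signed_partition_add2 _ 0)/signed_partition0.
  apply: (cyclic (fun=> 0)); have -> : (w = 0 + 4 * w./2./2)%N by lia.
  exact/signed_partition_add4/signed_partition0.
(* For odd [w], hence [w >= 3], a cyclic group of odd order allows Kotzig triples; one of even order
   is split into pairs of rows, with bundles of size [2 * w], which is 6 modulo 4. *)
have [od|evd] := boolP (odd d.+1).
  have eqd : d = d./2.*2 by rewrite even_halfK.
  have [F PF] := signed_partition3 (c * k0) d./2; rewrite -eqd in PF.
  have := odd_double_half w./2; case: (odd w./2) => [|] /= ew2.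
    apply: (cyclic F); have -> : (w = 3 + 4 * w./2./2)%N by lia.
    exact: signed_partition_add4.
  apply: (cyclic (fun a => F a + 2)).
  have -> : (w = 5 + 4 * (w./2./2).-1)%N by lia.
  exact/signed_partition_add4/(@signed_partition_add2 _ 3).
have eqd : d.+1 = (d.+1./2.-1.+1 * 2)%N by rewrite muln2; lia.
have P : signed_partition (c * k0 * d.+1./2.-1.+1) (e * 2 * s0) (fun=> 0).
  have -> : (e * 2 * s0 = 6 + 4 * (w./2 - 1))%N by rewrite mulnAC -/w; lia.
  exact/signed_partition_add4/signed_partition6.
have ed2 : (e <= d.+1./2.-1.+1)%N by lia.
have := MRS_even_paired ed2 P; rewrite -eqd es ek es0 ek0 em en.
by rewrite [(d.+1 * k0)%N]mulnC [(d.+1 * s0)%N]mulnC [(k0 * e)%N]mulnC mulnAC.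
Qed.

Lemma MRS_even m n s k c : (2 <= s <= n)%N -> (2 <= k <= m)%N -> (m * s = n * k)%N ->
  ~~ odd s -> ~~ odd k -> (4 < s * k)%N -> MRS_exists m n s k c.
Proof.
move=> sn km eqT os ok sk.
have [s4|s3] := leqP 4 s; first by apply: MRS_even_wide => //; rewrite s4; case/andP: sn.
(* Here [s = 2], so [s * k > 4] and the parity of [k] give [k >= 4], and the transposed array is
   wide. *)
apply: MRS_exists_transpose => //; apply: MRS_even_wide => //.
have es : s = 2%N by case: s sn os {eqT sk} s3 => [|[|[|[|]]]].
have : ~~ (k == 3) by apply: contraNN ok => /eqP ->.
by case/andP: km => _ ->; move: sk; rewrite es andbT; lia.
Qed.

Local Close Scope ring_scope.

Theorem mainTheorem1 (m n s k c : nat) :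
  0 < m -> 0 < n -> 0 < s -> 0 < k -> 0 < c ->
  2 <= s <= n -> 2 <= k <= m -> m * s = n * k ->
  (MRS_exists m n s k c <->
     (odd (n * k * c) \/ (~~ odd s /\ ~~ odd k /\ 4 < s * k))).
Proof.
move=> m0 n0 s0 k0 c0 sn km eqT; split.
  by apply: MRS_necessary => //; [case/andP: sn | case/andP: km].
case=> [|[os [ok sk]]]; first exact: MRS_odd.
exact: MRS_even.
Qed.
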